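(* Let $M$ be a smooth manifold and let $B\in\Gamma(\mathrm T^*M\otimes \mathrm T^*M)$ be a non-degenerate 2-covariant tensor field, with skew-symmetric part $\omega$ and symmetric part $S$, such that $\mathrm TM=\mathcal H\oplus\mathcal V$, where $\mathcal H=\operatorname{Ker}S$ and $\mathcal V=\operatorname{Ker}\omega$. Then $$\tfrac12\llbracket\omega,\omega\rrbracket=(\mathsf\Lambda^3\,{}^{t}\mathrm{pr}_{\mathcal H})(\mathrm d\omega)+\tfrac12\,\widehat S\,\barwedge\,\mathrm{curv}_{\mathcal H},$$ where $\llbracket\cdot,\cdot\rrbracket$ is the conjugate Schouten–Nijenhuis bracket associated with $B$.
   Context: Manifolds are smooth and paracompact, and all objects are smooth; $\mathcal H$ and $\mathcal V$ are vector subbundles of $\mathrm TM$. For a 2-covariant tensor field $T$, $\widehat T(v)=T(v,\cdot)$ and ${}^{t}\widehat T(v)=T(\cdot,v)$ as maps $\mathrm TM\to \mathrm T^*M$; $\operatorname{Ker}T$ means $\operatorname{Ker}\widehat T$. $B$ is non-degenerate if $\widehat B$ is an isomorphism. $\omega(u,v)=\frac12(B(u,v)-B(v,u))$, $S(u,v)=\frac12(B(u,v)+B(v,u))$. $\mathsf\Lambda^kF$ is the map induced by $F$ on $k$-th exterior powers (determinant convention). $\mathrm{pr}_{\mathcal H},\mathrm{pr}_{\mathcal V}\colon \mathrm TM\to \mathrm TM$ are the projections of $\mathrm TM=\mathcal H\oplus\mathcal V$; $X_{\mathcal H}=\mathrm{pr}_{\mathcal H}X$, $X_{\mathcal V}=\mathrm{pr}_{\mathcal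 V}X$; $\big((\mathsf\Lambda^3\,{}^{t}\mathrm{pr}_{\mathcal H})(\gamma)\big)(X,Y,Z)=\gamma(X_{\mathcal H},Y_{\mathcal H},Z_{\mathcal H})$. The curvature of $\mathcal H$ is the $\mathrm TM$-valued 2-form $\mathrm{curv}_{\mathcal H}(X,Y)=\mathrm{pr}_{\mathcal V}[X_{\mathcal H},Y_{\mathcal H}]$. The 3-form $\widehat S\barwedge\mathrm{curv}_{\mathcal H}$ is the exterior product of the $\mathrm T^*M$-valued 1-form $\widehat S$ with the $\mathrm TM$-valued 2-form $\mathrm{curv}_{\mathcal H}$ via the canonical pairing, namely $$(\widehat S\barwedge\mathrm{curv}_{\mathcal H})(X,Y,Z)=2\big(S(X,\mathrm{curv}_{\mathcal H}(Y,Z))+S(Y,\mathrm{curv}_{\mathcal H}(Z,X))+S(Z,\mathrm{curv}_{\mathcal H}(X,Y))\big).$$ $[\cdot,\cdot]$ on multivector fields is the Schouten–Nijenhuis bracket, with the sign convention: it extends the Lie bracket of vector fields, $[X,f]=X(f)$, $[P,Q]=-(-1)^{(p-1)(q-1)}[Q,P]$ and $[P,Q\wedge R]=[P,Q]\wedge R+(-1)^{(p-1)q}Q\wedge[P,R]$ for multivector fields of degrees $p,q,r$. The conjugate bracket associated with $B$ is, for $\alpha\in\Omega^a(M)$, $\beta\in\Omega^b(M)$, $$\llbracket\alpha,\beta\rrbracket=\mathsf\Lambda^{a+b-1}\,{}^{t}\widehat B\Big(\big[\mathsf\Lambda^{a}\,({}^{t}\widehat B)^{-1}(\alpha),\ \mathsf\Lambda^{b}\,({}^{t}\widehat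 B)^{-1}(\beta)\big]\Big)\in\Omega^{a+b-1}(M).$$ *)

(* Defs.v *)
From HB Require Import structures.
From mathcomp Require Import all_boot all_order all_algebra.
From mathcomp Require Import all_classical all_reals all_analysis.
Set Implicit Arguments.
Unset Strict Implicit.
Unset Printing Implicit Defensive.
Import Order.TTheory GRing.Theory Num.Theory.
Import numFieldNormedType.Exports.
Local Open Scope classical_set_scope.
Local Open Scope ring_scope.

Section SmoothOn.
Context {R : realType} {n : nat}.

Fixpoint iter_partial {V : normedModType R} (s : seq 'I_n)
    (f : 'rV[R]_n -> V) : 'rV[R]_n -> V :=
  if s is i :: s' then iter_partial s' ('D_(delta_mx 0 i) f) else f.

(* Used for U open only: 'D and differentiable at a point of U then depend only
   on f near that point. As differentiability implies continuity, this says that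
   f is C^k on U for every k. *)
Definition smooth_on {V : normedModType R} (U : set 'rV[R]_n)
    (f : 'rV[R]_n -> V) : Prop :=
  forall (s : seq 'I_n) (x : 'rV[R]_n), U x -> differentiable (iter_partial s f) x.

Lemma near_eq_differentiable (V W : normedModType R) (f g : V -> W) (x : V) :
  (\near x, f x = g x) -> differentiable f x -> differentiable g x.
Proof.
move=> fg df; have fgx : f x = g x by exact: nbhs_singleton fg.
have [cf /eqaddoP ef] := (diff_locallyP x f).1 df.
have eg : g \o shift x = cst (g x) + 'd f x +o_ 0 id.
  apply/eqaddoP => e e0; have := ef e e0.
  have fg' : \forall h \near 0, f (h + x) = g (h + x).
    by move: fg; rewrite (near_shift 0) subr0.
  apply: filterS2 fg' => h /= fgh; rewrite !fctE /= fgx fgh; exact.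
apply/diff_locallyP; rewrite (diff_unique cf eg); split; first exact: cf.
exact: eg.
Qed.

Definition diff_upto {V : normedModType R} (U : set 'rV[R]_n) (k : nat)
    (f : 'rV[R]_n -> V) : Prop :=
  forall s x, (size s <= k)%N -> U x -> differentiable (iter_partial s f) x.

Section Closure.
Context {V : normedModType R} (U : set 'rV[R]_n) (oU : open U).
Implicit Types (f g : 'rV[R]_n -> V) (u v : 'rV[R]_n -> R).

Let nearU f g (x : 'rV[R]_n) : {in U, f =1 g} -> U x -> \near x, f x = g x.
Proof.
move=> fg Ux; have := open_nbhs_nbhs (conj oU Ux).
by apply: filterS => y Uy; apply: fg; rewrite inE.
Qed.

Lemma diff_upto_eq k f g : {in U, f =1 g} -> diff_upto U k f -> diff_upto U k g.
Proof.
move=> fg df s x sk Ux; move: (df s x sk Ux) => {df sk}.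
elim: s f g fg => [|i s IHs] f g fg /=.
  by apply: near_eq_differentiable; exact: nearU.
apply: IHs => y; rewrite inE => Uy.
by apply: near_eq_derive; exact: nearU.
Qed.

Lemma diff_uptoS k f : (forall x, U x -> differentiable f x) ->
  (forall i, diff_upto U k ('D_(delta_mx 0 i) f)) -> diff_upto U k.+1 f.
Proof. by move=> f0 fS [|i s] x /= sk Ux; [exact: f0|exact: (fS i)]. Qed.

Lemma diff_upto_partial k f i :
  diff_upto U k.+1 f -> diff_upto U k ('D_(delta_mx 0 i) f).
Proof. by move=> df s x sk Ux; exact: (df (i :: s)). Qed.

Lemma diff_upto_le k l f : (k <= l)%N -> diff_upto U l f -> diff_upto U k f.
Proof. by move=> kl df s x sk; apply: df; exact: leq_trans kl. Qed.

Lemma smooth_on_cst (a : V) : smooth_on U (cst a).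
Proof.
move=> s x _; elim: s a => [|i s IHs] a /=; first exact: differentiable_cst.
rewrite (_ : 'D_(delta_mx 0 i) (cst a) = cst 0) //.
by apply/funext => y; rewrite derive_cst.
Qed.

Lemma diff_upto_lin k (a : R) f g :
  diff_upto U k f -> diff_upto U k g -> diff_upto U k (a *: f + g).
Proof.
elim: k f g => [|k IHk] f g df dg.
  by move=> [|//] x _ Ux /=; apply: differentiableD;
    [apply: differentiableZ; exact: (df [::])|exact: (dg [::])].
apply: diff_uptoS => [x Ux|i].
  by apply: differentiableD;
    [apply: differentiableZ; exact: (df [::])|exact: (dg [::])].
apply: (@diff_upto_eq _ (a *: 'D_(delta_mx 0 i) f + 'D_(delta_mx 0 i) g)).
  move=> x; rewrite inE => Ux; rewrite deriveD ?deriveZ //.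
  - by apply: diff_derivable; exact: (df [::]).
  - by apply: derivableZ; apply: diff_derivable; exact: (df [::]).
  - by apply: diff_derivable; exact: (dg [::]).
by apply: IHk; exact: diff_upto_partial.
Qed.

End Closure.

Lemma diff_uptoM (U : set 'rV[R]_n) k (f g : 'rV[R]_n -> R) : open U ->
  diff_upto U k f -> diff_upto U k g -> diff_upto U k (f * g).
Proof.
move=> oU; elim: k f g => [|k IHk] f g df dg.
  move=> [|//] x _ Ux /=.
  by apply: differentiableM; [exact: (df [::])|exact: (dg [::])].
apply: diff_uptoS => [x Ux|i].
  by apply: differentiableM; [exact: (df [::])|exact: (dg [::])].
apply: (@diff_upto_eq _ U oU _
  (1 *: (f * 'D_(delta_mx 0 i) g) + g * 'D_(delta_mx 0 i) f)).
  move=> x; rewrite inE => Ux; rewrite deriveM; first by rewrite scale1r.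
  - by apply: diff_derivable; exact: (df [::]).
  - by apply: diff_derivable; exact: (dg [::]).
apply: diff_upto_lin => //; apply: IHk.
- exact: diff_upto_le df.
- exact: diff_upto_partial.
- exact: diff_upto_le dg.
- exact: diff_upto_partial.
Qed.

Lemma smooth_on_lin {V : normedModType R} (U : set 'rV[R]_n) (a : R)
  (f g : 'rV[R]_n -> V) : open U ->
  smooth_on U f -> smooth_on U g -> smooth_on U (a *: f + g).
Proof.
move=> oU df dg s x Ux.
by apply: (@diff_upto_lin V U oU (size s)) => // t y _; [exact: df|exact: dg].
Qed.

Lemma smooth_onM (U : set 'rV[R]_n) (f g : 'rV[R]_n -> R) : open U ->
  smooth_on U f -> smooth_on U g -> smooth_on U (f * g).
Proof.
move=> oU df dg s x Ux.
by apply: (@diff_uptoM U (size s)) => // t y _; [exact: df|exact: dg].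
Qed.

End SmoothOn.

Definition locally_finite {T : topologicalType} (F : set (set T)) : Prop :=
  forall x : T, exists2 U : set T, nbhs x U &
    finite_set [set A | F A /\ A `&` U !=set0].

Definition open_cover {T : topologicalType} (F : set (set T)) : Prop :=
  (forall A, F A -> open A) /\ \bigcup_(A in F) A = setT.

Definition paracompact (T : topologicalType) : Prop :=
  forall F : set (set T), open_cover F ->
  exists G : set (set T), [/\ open_cover G, locally_finite G &
    forall A, G A -> exists2 A', F A' & A `<=` A'].

(* A homeomorphism between open subsets of T and of R^n. The values of the two
   maps outside chart_dom and its image are irrelevant. *)
Record chart (R : realType) (n : nat) (T : topologicalType) := Chart {
  chart_dom : set T;
  chart_map : T -> 'rV[R]_n;
  chart_inv : 'rV[R]_n -> T;
  _ : open chart_dom;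
  _ : open (chart_map @` chart_dom);
  _ : {in chart_dom, cancel chart_map chart_inv};
  _ : {within chart_dom, continuous chart_map};
  _ : {within chart_map @` chart_dom, continuous chart_inv} }.

Definition compatible_charts (R : realType) (n : nat) (T : topologicalType)
    (c d : chart R n T) : Prop :=
  smooth_on (chart_map c @` (chart_dom c `&` chart_dom d))
    (chart_map d \o chart_inv c).

(* The atlas need not be maximal: smoothness of functions does not depend on the
   choice of an atlas inside the maximal one. *)
Record manifold (R : realType) (n : nat) := Manifold {
  manifold_sort :> topologicalType;
  atlas : set (chart R n manifold_sort);
  _ : hausdorff_space manifold_sort;
  _ : paracompact manifold_sort;
  _ : \bigcup_(c in atlas) chart_dom c = setT;
  _ : forall c d, atlas c -> atlas d -> compatible_charts c d }.

Section SmoothFunctions.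
Context {R : realType} {n : nat} (M : manifold R n).

Definition smooth (f : M -> R) : Prop := forall c : chart R n M, atlas c ->
  smooth_on (chart_map c @` chart_dom c) (f \o chart_inv c).

Definition smooth_pred : {pred M -> R} := fun f => `[< smooth f >].

Let open_chart (c : chart R n M) : open (chart_map c @` chart_dom c).
Proof. by case: c. Qed.

Let smooth_lin (a : R) (f g : M -> R) :
  smooth f -> smooth g -> smooth (a *: f + g).
Proof.
by move=> sf sg c cA; apply: (@smooth_on_lin _ _ _ _ a (f \o _) (g \o _));
  [exact: open_chart|exact: sf|exact: sg].
Qed.

Let smoothM (f g : M -> R) : smooth f -> smooth g -> smooth (f * g).
Proof.
by move=> sf sg c cA; apply: (@smooth_onM _ _ _ (f \o _) (g \o _));
  [exact: open_chart|exact: sf|exact: sg].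
Qed.

Let smooth_cst (a : R) : smooth (cst a).
Proof. by move=> c _; exact: smooth_on_cst. Qed.

Lemma smooth_subring : subring_closed smooth_pred.
Proof.
split; first by apply/asboolP; exact: smooth_cst.
- move=> f g /asboolP sf /asboolP sg; apply/asboolP.
  by rewrite addrC -scaleN1r; exact: smooth_lin.
- by move=> f g /asboolP sf /asboolP sg; apply/asboolP; exact: smoothM.
Qed.

Lemma smooth_scale : GRing.scaler_closed smooth_pred.
Proof.
move=> a f /asboolP sf; apply/asboolP; rewrite -[_ *: _]addr0.
by apply: smooth_lin => //; exact: smooth_cst.
Qed.

HB.instance Definition _ :=
  GRing.isSubringClosed.Build (M -> R) smooth_pred smooth_subring.
HB.instance Definition _ :=
  GRing.isScaleClosed.Build R (M -> R) smooth_pred smooth_scale.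

(* C^oo(M) *)
Record smoothfun := SmoothFun {
  smoothfun_val :> M -> R;
  _ : smoothfun_val \in smooth_pred }.

HB.instance Definition _ := [isSub for smoothfun_val].
HB.instance Definition _ := [Choice of smoothfun by <:].
HB.instance Definition _ := GRing.SubChoice_isSubComPzRing.Build
  (M -> R) smooth_pred smoothfun smooth_subring.
HB.instance Definition _ := [SubZmodule_isSubLmodule of smoothfun by <:].

Lemma smooth_scalerAl (a : R) (f g : smoothfun) : a *: f * g = a *: (f * g).
Proof. by apply/val_inj/funext => x; exact: (esym (mulrA a (f x) (g x))). Qed.

Lemma smooth_scalerAr (a : R) (f g : smoothfun) : f * (a *: g) = a *: (f * g).
Proof. by rewrite mulrC smooth_scalerAl mulrC. Qed.

End SmoothFunctions.

(* A vector bundle is handled through its C^oo(M)-module of smooth sections: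
   Gamma(TM) is the module of R-derivations of C^oo(M), and a tensor field is a
   C^oo(M)-multilinear map on sections. For bundle maps over the identity,
   injectivity, bijectivity, kernels of constant rank and direct sum
   decompositions correspond to the same notions for the modules of sections; in
   particular hat T is a bundle isomorphism iff it is bijective on sections. *)

Section VectorFields.
Context {R : realType} {n : nat} (M : manifold R n).
Local Notation C := (smoothfun M).

Definition is_derivation (D : C -> C) : Prop :=
  linear D /\ forall f g : C, D (f * g) = D f * g + f * D g.

Definition derivation : {pred C -> C^o} := fun D => `[< is_derivation D >].

Lemma derivation_submod : submod_closed derivation.
Proof.
split.
  apply/asboolP; split=> [a u v|f g].
    by rewrite -[LHS]/(0 : C) -[RHS]/(a *: (0 : C) + 0) scaler0 addr0.
  by rewrite -[LHS]/(0 : C) -[RHS]/((0 : C) * g + f * 0) mul0r mulr0 addr0.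
move=> h D E /asboolP[Dl DM] /asboolP[El EM]; apply/asboolP; split=> [a u v|f g].
  rewrite -[LHS]/(h * D (a *: u + v) + E (a *: u + v)).
  rewrite -[RHS]/(a *: (h * D u + E u) + (h * D v + E v)) Dl El.
  by rewrite mulrDr smooth_scalerAr scalerDr addrACA.
rewrite -[LHS]/(h * D (f * g) + E (f * g)).
rewrite -[RHS]/((h * D f + E f) * g + f * (h * D g + E g)) DM EM.
by rewrite !mulrDr !mulrDl !mulrA [f * h]mulrC addrACA.
Qed.

HB.instance Definition _ :=
  GRing.isSubmodClosed.Build C (C -> C^o) derivation derivation_submod.

(* Gamma(TM), a C^oo(M)-module *)
Record vfield := VField {
  vfield_val :> C -> C;
  _ : vfield_val \in derivation }.

HB.instance Definition _ := [isSub for (vfield_val : vfield -> (C -> C^o))].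
HB.instance Definition _ := [Choice of vfield by <:].
HB.instance Definition _ := [SubChoice_isSubLmodule of vfield by <:].

Lemma vfieldP (X : vfield) : is_derivation X.
Proof. exact: (asboolW (valP X)). Qed.

Lemma lie_subproof (X Y : vfield) : (fun f : C => X (Y f) - Y (X f)) \in derivation.
Proof.
have [Xl XM] := vfieldP X; have [Yl YM] := vfieldP Y.
have XD u v : X (u + v) = X u + X v by rewrite -[u]scale1r Xl !scale1r.
have YD u v : Y (u + v) = Y u + Y v by rewrite -[u]scale1r Yl !scale1r.
apply/asboolP; split=> [a u v|f g].
  by rewrite Xl Yl Xl Yl scalerBr opprD addrACA.
rewrite YM XM XD YD !XM !YM mulrBl mulrBr.
set a := X (Y f) * g; set b := Y f * X g; set c := X f * Y g.
set d := f * X (Y g); set e := Y (X f) * g; set h := f * Y (X g).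
rewrite (_ : a + b + (c + d) = (a + d) + (b + c)); last first.
  by rewrite [c + d]addrC addrACA.
rewrite (_ : e + c + (b + h) = (e + h) + (b + c)); last first.
  by rewrite [b + h]addrC addrACA [c + b]addrC.
by rewrite opprD addrACA subrr addr0 opprD addrACA.
Qed.

Definition lie (X Y : vfield) : vfield := VField (lie_subproof X Y).

Definition is_form1 : {pred vfield -> C^o} := fun a => `[< linear a >].

Lemma form1_submod : submod_closed is_form1.
Proof.
split.
  apply/asboolP => h u v.
  by rewrite -[LHS]/(0 : C^o) -[RHS]/(h *: (0 : C^o) + 0) scaler0 addr0.
move=> h a b /asboolP la /asboolP lb; apply/asboolP => k u v.
rewrite -[LHS]/(h *: (a (k *: u + v) : C^o) + b (k *: u + v)).
rewrite -[RHS]/(k *: (h *: (a u : C^o) + b u) + (h *: (a v : C^o) + b v)) la lb !scalerDr addrACA !scalerA [h * k]mulrC //.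
Qed.

HB.instance Definition _ :=
  GRing.isSubmodClosed.Build C (vfield -> C^o) is_form1 form1_submod.

(* Gamma(T^*M), a C^oo(M)-module *)
Record form1 := Form1 {
  form1_val :> vfield -> C;
  _ : form1_val \in is_form1 }.

HB.instance Definition _ := [isSub for (form1_val : form1 -> (vfield -> C^o))].
HB.instance Definition _ := [Choice of form1 by <:].
HB.instance Definition _ := [SubChoice_isSubLmodule of form1 by <:].

Definition bilinear_fun (T : vfield -> vfield -> C) : Prop :=
  (forall Y, linear (T^~ Y : vfield -> C^o)) /\
  (forall X, linear (T X : vfield -> C^o)).

(* Gamma(T^*M (x) T^*M) *)
Record tensor2 := Tensor2 {
  tensor2_val :> vfield -> vfield -> C;
  tensor2P : bilinear_fun tensor2_val }.

Lemma hat_subproof (T : tensor2) (X : vfield) : T X \in is_form1.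
Proof. by apply/asboolP; case: (tensor2P T). Qed.

Definition hat (T : tensor2) (X : vfield) : form1 := Form1 (hat_subproof T X).

Definition nondeg_tensor (T : tensor2) : Prop := bijective (hat T).

(* the sections of Ker T *)
Definition tensor_ker (T : tensor2) : set vfield := [set X | hat T X = 0].

Lemma half_subproof (e : R) (T : tensor2) :
  bilinear_fun (fun X Y => (2^-1 : R) *: (T X Y + e *: T Y X)).
Proof.
have [Tl Tr] := tensor2P T; split=> Z h X Y.
  rewrite Tl Tr -[LHS]/(2^-1 *: (h * T X Z + T Y Z + e *: (h * T Z X + T Z Y))).
  rewrite -[RHS]/(h * (2^-1 *: (T X Z + e *: T Z X)) + 2^-1 *: (T Y Z + e *: T Z Y)).
  by rewrite smooth_scalerAr -scalerDr mulrDr smooth_scalerAr !scalerDr addrACA.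
rewrite Tl Tr -[LHS]/(2^-1 *: (h * T Z X + T Z Y + e *: (h * T X Z + T Y Z))).
rewrite -[RHS]/(h * (2^-1 *: (T Z X + e *: T X Z)) + 2^-1 *: (T Z Y + e *: T Y Z)).
by rewrite smooth_scalerAr -scalerDr mulrDr smooth_scalerAr !scalerDr addrACA.
Qed.

Lemma sym_subproof (T : tensor2) :
  bilinear_fun (fun X Y => (2^-1 : R) *: (T X Y + T Y X)).
Proof.
by have := half_subproof 1 T; under eq_fun do under eq_fun do rewrite scale1r.
Qed.

Lemma skew_subproof (T : tensor2) :
  bilinear_fun (fun X Y => (2^-1 : R) *: (T X Y - T Y X)).
Proof.
by have := half_subproof (-1) T; under eq_fun do under eq_fun do rewrite scaleN1r.
Qed.

Definition sym_part (T : tensor2) : tensor2 := Tensor2 (sym_subproof T).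
Definition skew_part (T : tensor2) : tensor2 := Tensor2 (skew_subproof T).

(* TM = H (+) V, for H and V given by their sections *)
Definition direct_sum (H V : set vfield) : Prop :=
  forall X : vfield, exists! Y : vfield, H Y /\ V (X - Y).

(* the projection onto H along V, when direct_sum H V *)
Definition proj_along (H V : set vfield) (X : vfield) : vfield :=
  xget 0 [set Y | H Y /\ V (X - Y)].

Definition curv (H V : set vfield) (X Y : vfield) : vfield :=
  proj_along V H (lie (proj_along H V X) (proj_along H V Y)).

End VectorFields.

(* For a module U over a commutative ring A, a k-form on U is represented by a
   function P of finite sequences of elements of U, vanishing on the sequences of
   length other than k, and multilinear and alternating in the entries: the value
   P(u_1, ..., u_k) is P [:: u_1; ...; u_k]. With U = Gamma(TM) these are the
   differential k-forms on M, with U = Gamma(T^*M) the k-vector fields on M. *)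

Section Alternating.
Context {A : comPzRingType} {U : lmodType A}.

Definition alternating (k : nat) (P : seq U -> A) : Prop :=
  [/\ forall s, size s != k -> P s = 0,
      forall s t (a : A) u v,
        P (s ++ (a *: u + v) :: t) = a * P (s ++ u :: t) + P (s ++ v :: t) &
      forall s t r u, P (s ++ u :: t ++ u :: r) = 0].

(* number of pairs i < j with m_i = false and m_j = true, i.e. of inversions of
   the shuffle that moves the positions selected by m to the front *)
Fixpoint shuffle_inv (m : bitseq) : nat :=
  if m is b :: m' then ((if b then 0 else count id m') + shuffle_inv m')%N else 0.

(* determinant convention: (u /\ v)(a, b) = u(a) v(b) - u(b) v(a) in degree 1 *)
Definition wedge (P Q : seq U -> A) (s : seq U) : A :=
  \sum_(m : (size s).-tuple bool)
    (-1) ^+ shuffle_inv m * (P (mask m s) * Q (mask (map negb m) s)).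

End Alternating.

(* The map induced on exterior powers (in all degrees at once) by the transpose of
   g : U -> U'. *)
Definition Lambda_tr {A U U' : Type} (g : U -> U') (P : seq U' -> A) : seq U -> A :=
  fun s => P (map g s).

Section Forms.
Context {R : realType} {n : nat} {M : manifold R n}.
Local Notation C := (smoothfun M).
Local Notation X := (vfield M).

Definition del {T : Type} (i : nat) (s : seq T) : seq T := take i s ++ drop i.+1 s.

(* (d a)(X_0, ..., X_k) = sum_i (-1)^i X_i(a(.., ^X_i, ..))
     + sum_(i < j) (-1)^(i+j) a([X_i, X_j], .., ^X_i, .., ^X_j, ..) *)
Definition extd (a : seq X -> C) (s : seq X) : C :=
  \sum_(i < size s) (-1) ^+ i * (s`_i : X) (a (del i s)) +
  \sum_(j < size s) \sum_(i < j)
    (-1) ^+ (i + j) * a (lie s`_i s`_j :: del i (del j s)).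

Definition form2 (w : tensor2 M) (s : seq X) : C :=
  if s is [:: Y; Z] then w Y Z else 0.

Definition barwedge (S : tensor2 M) (K : X -> X -> X) (s : seq X) : C :=
  if s is [:: Y1; Y2; Y3] then
    2%:R * (S Y1 (K Y2 Y3) + S Y2 (K Y3 Y1) + S Y3 (K Y1 Y2))
  else 0.

End Forms.

Section Multivectors.
Context {R : realType} {n : nat} {M : manifold R n}.
Local Notation C := (smoothfun M).
Local Notation multivector := (seq (form1 M) -> C).

Definition mv_fun (f : C) : multivector := fun s => if s is [::] then f else 0.

Definition mv_vfield (X : vfield M) : multivector :=
  fun s => if s is [:: a] then a X else 0.

(* The Schouten-Nijenhuis bracket is the unique operation with these properties
   (its values outside homogeneous multivector fields are irrelevant). The signs
   (-1)^((p-1)(q-1)) and (-1)^((p-1)q) are written with p+1 and q+1 instead of p-1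
   and q-1 so as to stay in nat. *)
Record schouten_nijenhuis (sn : multivector -> multivector -> multivector) : Prop := {
  sn_degree : forall p q (P Q : multivector), alternating p P -> alternating q Q ->
    (0 < p + q)%N -> alternating (p + q).-1 (sn P Q);
  sn_degree0 : forall P Q : multivector, alternating 0 P -> alternating 0 Q -> sn P Q = 0;
  sn_linear : forall p q (c : R) (P P' Q : multivector), alternating p P -> alternating p P' ->
    alternating q Q -> sn (c *: P + P') Q = c *: sn P Q + sn P' Q;
  sn_lie : forall X Y, sn (mv_vfield X) (mv_vfield Y) = mv_vfield (lie X Y);
  sn_app : forall X f, sn (mv_vfield X) (mv_fun f) = mv_fun (X f);
  sn_skew : forall p q (P Q : multivector), alternating p P -> alternating q Q ->
    sn P Q = - (((-1) ^+ (p.+1 * q.+1) : R) *: sn Q P);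
  sn_leibniz : forall p q r (P Q S : multivector),
    alternating p P -> alternating q Q -> alternating r S ->
    sn P (wedge Q S) = wedge (sn P Q) S + ((-1) ^+ (p.+1 * q) : R) *: wedge Q (sn P S) }.

(* (hat B)^-1, meaningful when B is nondegenerate *)
Definition hat_inv (B : tensor2 M) (a : form1 M) : vfield M :=
  xget 0 [set Y | hat B Y = a].

(* t(hat B) : TM -> T^*M is the transpose of hat B and (t(hat B))^-1 is the
   transpose of (hat B)^-1. *)
Definition conj_bracket (sn : multivector -> multivector -> multivector)
    (B : tensor2 M) (a b : seq (vfield M) -> C) : seq (vfield M) -> C :=
  Lambda_tr (hat B) (sn (Lambda_tr (hat_inv B) a) (Lambda_tr (hat_inv B) b)).

End Multivectors.

(* Main.v *)
Require Import Defs.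
From HB Require Import structures.
From mathcomp Require Import all_boot all_order all_algebra.
From mathcomp Require Import all_classical all_reals all_analysis.
From mathcomp Require Import ring zify.
Import Order.TTheory GRing.Theory Num.Theory.
Import numFieldNormedType.Exports.
Local Open Scope classical_set_scope.
Local Open Scope ring_scope.
Set Implicit Arguments.
Unset Strict Implicit.
Unset Printing Implicit Defensive.

(** The theorem compares two alternating 3-linear functions of vector fields.
Write P for the bivector field that corresponds to w under hat B, and
{f, g} = P(df, dg).  The left-hand side is [P, P] / 2 evaluated on the forms
hat B X, hat B Y, hat B Z.  The classical identity
    [P, P](df, dg, dh) = 2 ({f, {g, h}} + {g, {h, f}} + {h, {f, g}})
(sn_bivector_self) describes it on exact forms.

As B = w + S, where S vanishes on H and w on V, the contraction of P with
hat B X is - X_H, and this turns the right-hand side into the sum over the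
cyclic permutations of (X, Y, Z) of
    B(X, [Y_H, Z_H]) + X_H (w(Y, Z)),
which is called horizontal_form below (horizontal_formE).  The part w of B
produces d w on the horizontal components, and the part S sees only the vertical
part of [Y_H, Z_H], which is the curvature.  The terms with derivatives of the
coefficients cancel, so that the sum is linear over the functions
(horizontal_form_linl), and when hat B X, hat B Y, hat B Z are exact it is the
jacobiator of { , } (horizontal_form_exact).  Locally every 1-form is a
combination of exact ones, so the two sides agree (exact_span).

The Schouten-Nijenhuis bracket is known only through its algebraic
properties, hence only on exterior products of vector fields.  To reach P one
needs a function r with r p <> 0 such that r P is a finite sum of such products
(local_decomposition), and then corrects for the factor r.  Both this
and exact_span come from a local frame (local_frame): derivations
E_1, ..., E_n of the algebra of functions and functions t, x_1, ..., x_n with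
    t^3 X = sum_i (t X(x_i) - x_i X(t)) E_i   for every derivation X.
Here t is a bump function theta in a chart with coordinates z_i, x_i = theta z_i
and E_i = theta d/dz_i.  That a derivation of the algebra of smooth functions is
determined by its values on the coordinates is Hadamard's lemma
(hadamard): f(z) - f(y) is the sum of the (z_i - y_i) g_i(z) with g_i smooth.
The functions g_i are integrals along the segments from y, and their smoothness
is differentiation under the integral sign (ray_integral_smooth). *)

(* multilinear alternating, not antiperiodic *)
Local Notation alternating := Defs.alternating.

(** * Differentials of functions of several variables *)

Section FrechetCriterion.
Context {R : realType}.

(** The differential is chosen among the continuous linear maps that satisfy the
first-order estimate, and such a map is unique, so exhibiting one both proves
differentiability and computes the differential. *)
Lemma differentiable_of_linear (V W : normedModType R) (f : V -> W) (x : V)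
    (df : {linear V -> W}) : continuous df ->
  (forall e : R, 0 < e ->
     \forall h \near (0 : V), `|f (x + h) - f x - df h| <= e * `|h|) ->
  differentiable f x /\ 'd f x = df :> (V -> W).
Proof.
move=> cdf fdf.
have eg : f \o shift x = cst (f x) + df +o_ 0 id.
  apply/eqaddoP => e e0; near=> h.
  rewrite /= !fctE /= opprD addrA [h + x]addrC.
  by near: h; exact: fdf.
have dE := diff_unique cdf eg.
by split => //; apply/diff_locallyP; rewrite dE; split.
Unshelve. all: by end_near. Qed.

Context {n : nat}.
Implicit Types (f : 'rV[R]_n -> R) (x h : 'rV[R]_n).

Definition lincomb (a : 'I_n -> R) h : R := \sum_i h 0 i * a i.

Lemma lincomb_is_linear a : linear (lincomb a).
Proof.
move=> c u v; rewrite /lincomb scaler_sumr -big_split /=.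
by apply: eq_bigr => i _; rewrite !mxE mulrDl -mulrA.
Qed.

HB.instance Definition _ a :=
  GRing.isLinear.Build R 'rV[R]_n R _ (lincomb a) (lincomb_is_linear a).

Lemma normr_coord h i : `|h 0 i| <= `|h|.
Proof.
rewrite [leRHS]/Num.norm /= mx_normrE.
exact: (le_bigmax _ (fun ij : 'I_1 * 'I_n => `|h ij.1 ij.2|) (0, i)).
Qed.

Lemma lincomb_le a h e : (forall i, `|a i| <= e) ->
  `|lincomb a h| <= n%:R * e * `|h|.
Proof.
move=> ae; apply: le_trans (ler_norm_sum _ _ _) _.
apply: (@le_trans _ _ (\sum_(i < n) e * `|h|)); last first.
  by rewrite sumr_const card_ord mulr_natl mulrnAl.
by apply: ler_sum => i _; rewrite normrM mulrC ler_pM // normr_coord.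
Qed.

Lemma lincomb_continuous a : continuous (lincomb a).
Proof.
move=> x; apply: differentiable_continuous.
rewrite (_ : lincomb a = \sum_(i < n) (fun h : 'rV[R]_n => h 0 i * a i)); last first.
  by apply/funext => h; rewrite fct_sumE.
apply: differentiable_sum => i; apply: differentiableM => //.
exact: differentiable_coord.
Qed.

Lemma lincomb_delta a i : lincomb a (delta_mx 0 i) = a i.
Proof.
rewrite /lincomb (bigD1 i) //= big1 => [|j ji]; rewrite !mxE ?eqxx ?mul1r ?addr0 //.
by rewrite (negPf ji) andbF mul0r.
Qed.

Lemma derive_lincomb f x h : differentiable f x ->
  'D_h f x = lincomb (fun i => 'D_(delta_mx 0 i) f x) h.
Proof.
move=> df; rewrite deriveE // [in LHS](row_sum_delta h) linear_sum.
by apply: eq_bigr => i _; rewrite linearZ /= -deriveE.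
Qed.

(** The two difference quotients are the same function. *)
Lemma is_derive_line (V W : normedModType R) (f : V -> W) (v h : V) (s : R) :
  differentiable f (v + s *: h) ->
  is_derive s 1 (fun t : R => f (v + t *: h)) ('D_h f (v + s *: h)).
Proof.
move=> df; have := @diff_derivable _ _ _ f (v + s *: h) h df.
pose g (t : R) := f (v + t *: h).
have E : (fun t : R => t^-1 *: ((g \o shift s) (t *: (1 : R)) - g s)) =
    (fun t : R => t^-1 *: ((f \o shift (v + s *: h)) (t *: h) - f (v + s *: h))).
  apply/funext => t /=; congr (_ *: (f _ - _)).
  by rewrite scaler1 scalerDl addrCA.
by move=> fd; split; [rewrite /derivable E|rewrite /derive E].
Qed.

End FrechetCriterion.

(** * Integrals over the unit interval *)

Section UnitIntegral.
Context {R : realType}.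
Implicit Types f g : R -> R.

Definition integral01 f : R := \int[lebesgue_measure]_(t in `[0, 1]) f t.

(** Continuity is asked at the points of [0, 1] inside the whole line, as holds
along a segment contained in an open set. *)
Definition continuous01 f : Prop :=
  forall t, t \in `[0, 1]%R -> {for t, continuous f}.

Let integrable01 f : continuous01 f ->
  (@lebesgue_measure R).-integrable `[0, 1] (EFin \o f).
Proof.
move=> cf; apply: continuous_compact_integrable; first exact: segment_compact.
by apply: continuous_in_subspaceT => t; rewrite inE => /cf.
Qed.

Lemma integral01_lin (a : R) f g : continuous01 f -> continuous01 g ->
  integral01 (fun t => a * f t + g t) = a * integral01 f + integral01 g.
Proof.
move=> cf cg; have mc : measurable (`[0, 1] : set R) by exact: measurable_itv.
rewrite /integral01 RintegralD //; last exact: (integrable01 cg).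
  by rewrite RintegralZl //; exact: (integrable01 cf).
apply: (@integrable01 (fun t => a * f t)) => t /cf cft.
by apply: cvgM => //; exact: cvg_cst.
Qed.

Lemma continuous01_lin (a : R) f g : continuous01 f -> continuous01 g ->
  continuous01 (fun t => a * f t + g t).
Proof.
by move=> cf cg t t01; apply: cvgD; [apply: cvgM; [exact: cvg_cst|exact: cf]|exact: cg].
Qed.

Lemma integral01_cst (a : R) : integral01 (cst a) = a.
Proof.
rewrite /integral01 Rintegral_cst //= lebesgue_measure_itv /= lte_fin ltr01.
by rewrite oppr0 adde0 mulr1.
Qed.

Lemma integral01_sum (n : nat) (a : 'I_n -> R) (f : 'I_n -> R -> R) :
  (forall i, continuous01 (f i)) ->
  continuous01 (fun t => \sum_i a i * f i t) /\
  integral01 (fun t => \sum_i a i * f i t) = \sum_i a i * integral01 (f i).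
Proof.
move=> cf; elim: (index_enum _) => [|i r [cr Ir]].
  under eq_fun do rewrite big_nil; rewrite big_nil (integral01_cst 0); split=> //.
  by move=> t _; exact: cvg_cst.
under eq_fun do rewrite big_cons; rewrite big_cons; split.
  exact: continuous01_lin.
by rewrite integral01_lin // Ir.
Qed.

Lemma integral01_le f (e : R) : continuous01 f ->
  (forall t : R, t \in `[0, 1]%R -> `|f t| <= e) -> `|integral01 f| <= e.
Proof.
move=> cf fe; have c x : continuous01 (cst x) by move=> t _; exact: cvg_cst.
rewrite -[leRHS]integral01_cst.
apply: le_trans (le_normr_Rintegral _ (integrable01 cf)) _ => //.
apply: le_Rintegral => //; [|exact: (integrable01 (c e))].
- by apply: (@integrable01 (fun t => `|f t|)) => t t01; apply: cvg_norm; exact: cf.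
Qed.

Lemma integral01_FTC f (F : R -> R) :
  continuous01 f -> (forall t : R, t \in `[0, 1]%R -> is_derive t 1 F (f t)) ->
  integral01 f = F 1 - F 0.
Proof.
move=> cf dF.
have cF (t : R) : t \in `[0, 1]%R -> {for t, continuous F}.
  move=> t01; have dFt := dF t t01.
  exact/differentiable_continuous/derivable1_diffP.
rewrite /integral01 /Rintegral (@continuous_FTC2 _ f F) //.
- by apply: continuous_in_subspaceT => t; rewrite inE => /cf.
- split.
  + by move=> t t01; have dFt := dF t (subset_itv_oo_cc t01).
  + by apply: cvg_at_right_filter; apply: cF; rewrite in_itv /= lexx ler01.
  + by apply: cvg_at_left_filter; apply: cF; rewrite in_itv /= lexx ler01.
- move=> t t01; have dFt := dF t (subset_itv_oo_cc t01).
  by rewrite derive1E derive_val.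
Qed.

End UnitIntegral.

(** * Hadamard's lemma *)

Section RayIntegral.
Context {R : realType} {n : nat}.
Implicit Types (f : 'rV[R]_n -> R) (U : set 'rV[R]_n).
Local Notation partial i f := ('D_(delta_mx 0 i) f).

(** The mean value theorem is applied to s |-> f (v + s h) - s df_v(h), whose
derivative is small because the partial derivatives vary little near u.  The
estimate is uniform in v, which is what compactness of a segment needs. *)
Lemma strict_differentiability U f u (e : R) : open U -> U u ->
  (forall v, U v -> differentiable f v) ->
  (forall i, {for u, continuous (partial i f)}) -> 0 < e ->
  \forall v \near u & h \near (0 : 'rV[R]_n),
    `|f (v + h) - f v - lincomb (fun i => partial i f v) h| <= e * `|h|.
Proof.
move=> oU Uu df cf e0.
(* two partial derivatives near u differ by 2 c, and there are n of them *)
pose c := e / n.+1%:R / 2.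
have c0 : 0 < c by rewrite !divr_gt0.
have /nbhs_ballP[d /= d0 Hd] : \forall v \near u,
    U v /\ forall i, `|partial i f u - partial i f v| <= c.
  apply: filterI; first exact: open_nbhs_nbhs.
  apply: (@filter_forall _ 'I_n (fun i v => `|partial i f u - partial i f v| <= c)
    _ (nbhs_filter u)) => i.
  by move/cvgrPdist_le: (cf i); apply.
exists (ball u (d / 2), ball 0 (d / 2)) => /=.
  by split; apply: nbhsx_ballx; rewrite divr_gt0.
case=> v h /= [bv bh].
have near_u (s : R) : s \in `[0, 1]%R -> ball u d (v + s *: h).
  rewrite in_itv /= => /andP[s0 s1]; rewrite [d]splitr.
  apply: (ball_triangle bv); rewrite -ball_normE /= opprD addNKr normrN normrZ.
  rewrite ger0_norm //; apply: le_lt_trans (_ : `|h| < _).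
    by rewrite ler_piMl.
  by move: bh; rewrite -ball_normE /= sub0r normrN.
pose a := lincomb (fun i => partial i f v) h.
pose g (s : R) := f (v + s *: h) - a * s.
have dg (s : R) : s \in `[0, 1]%R ->
    is_derive s 1 g (lincomb (fun i => partial i f (v + s *: h)) h - a).
  move=> /near_u/Hd[Us _].
  have df1 := is_derive_line (df _ Us).
  rewrite -derive_lincomb; last exact: df.
  apply: is_deriveB; have := is_deriveZ a (is_derive_id s (1 : R)).
  by rewrite [a *: _]mulr1.
have cg : {within `[0, 1], continuous g}.
  apply: continuous_in_subspaceT => s; rewrite inE => /dg dgs.
  exact/differentiable_continuous/derivable1_diffP.
have [s s01] := MVT ltr01 (fun s h => dg s (subset_itv_oo_cc h)) cg.
rewrite /g scale1r scale0r mulr1 mulr0 subr0 addr0 subr0 mulr1.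
rewrite addrAC => ->.
have -> : lincomb (fun i => partial i f (v + s *: h)) h - a =
    lincomb (fun i => partial i f (v + s *: h) - partial i f v) h.
  by rewrite /a /lincomb -sumrB; apply: eq_bigr => i _; rewrite mulrBr.
have ac i : `|partial i f (v + s *: h) - partial i f v| <= c + c.
  have [_ /(_ i) h1] := Hd _ (near_u s (subset_itv_oo_cc s01)).
  have /near_u/Hd[_ /(_ i)] : (0 : R) \in `[0, 1]%R by rewrite in_itv /= lexx ler01.
  rewrite scale0r addr0 => h2.
  rewrite -(subrK (partial i f u) (partial i f (v + s *: h))) -addrA.
  by apply: le_trans (ler_normD _ _) _; apply: lerD => //; rewrite distrC.
apply: le_trans (lincomb_le _ ac) _.
rewrite ler_wpM2r // /c -splitr mulrCA ler_piMr ?ltW //.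
by rewrite ltr_pdivrMr // mul1r ltr_nat.
Qed.


Definition star_shaped y U : Prop :=
  forall z (t : R), U z -> t \in `[0, 1]%R -> U (y + t *: (z - y)).

(** The weight t ^ k makes the family closed under partial derivatives:
differentiating f (y + t (z - y)) in z produces a factor t. *)
Definition ray_integral (y : 'rV[R]_n) (k : nat) f z : R :=
  integral01 (fun t => t ^+ k * f (y + t *: (z - y))).

Section AtCentre.
Variables (U : set 'rV[R]_n) (y : 'rV[R]_n).
Hypotheses (oU : open U) (sU : star_shaped y U).

Lemma continuous01_ray f z k : (forall v, U v -> {for v, continuous f}) ->
  U z -> continuous01 (fun t => t ^+ k * f (y + t *: (z - y))).
Proof.
move=> cf Uz t t01; apply: cvgM; first exact: exprn_continuous.
apply: continuous_comp; last exact: cf (sU Uz t01).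
apply: cvgD; first exact: cvg_cst.
by apply: cvgZ; [exact: cvg_id|exact: cvg_cst].
Qed.

(** Strict differentiability of f holds uniformly along the compact segment from
y to z, so its first-order estimate can be integrated in t. *)
Lemma ray_integral_differentiable f z k :
  (forall v, U v -> differentiable f v) ->
  (forall i v, U v -> {for v, continuous (partial i f)}) -> U z ->
  differentiable (ray_integral y k f) z /\
  forall i, partial i (ray_integral y k f) z = ray_integral y k.+1 (partial i f) z.
Proof.
move=> df cdf Uz; pose a i := ray_integral y k.+1 (partial i f) z.
have cf v : U v -> {for v, continuous f}.
  by move=> /df; exact: differentiable_continuous.
suff [dJ eJ] : differentiable (ray_integral y k f) z /\
    'd (ray_integral y k f) z = lincomb a :> (_ -> _).
  by split=> // i; rewrite deriveE // eJ lincomb_delta.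
apply: differentiable_of_linear => [|e e0]; first exact: lincomb_continuous.
(* the estimate to be integrated, for all t at once *)
have cover : \forall h \near (0 : 'rV[R]_n), `[0, 1] `<=` [set t : R |
    `|f (y + t *: (z - y) + t *: h) - f (y + t *: (z - y)) -
      lincomb (fun i => partial i f (y + t *: (z - y))) (t *: h)| <= e * `|t *: h|].
  apply: ((compact_near_coveringP _).1 (@segment_compact R 0 1) _ _ _
    (nbhs_filter (0 : 'rV[R]_n))) => t t01.
  have Ut := sU Uz t01.
  have S := strict_differentiability oU Ut df (fun i => cdf i _ Ut) e0.
  have C : (fun th : R * 'rV[R]_n => (y + th.1 *: (z - y), th.1 *: th.2)) th
      @[th --> (t, (0 : 'rV[R]_n))] --> (y + t *: (z - y), (0 : 'rV[R]_n)).
    apply: (@cvg_pair _ _ _ _ _ _ (nbhs_filter _) (nbhs_filter _) (nbhs_filter _)).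
      apply: cvgD; first exact: cvg_cst.
      by apply: cvgZ; [exact: cvg_fst|exact: cvg_cst].
    suff: (fun th : R * 'rV[R]_n => th.1 *: th.2) th @[th --> (t, (0 : 'rV[R]_n))]
        --> t *: (0 : 'rV[R]_n) by rewrite scaler0.
    by apply: cvgZ; [exact: cvg_fst|exact: cvg_snd].
  exact: C S.
have UN : \forall h \near (0 : 'rV[R]_n), U (z + h).
  have : \forall v \near z, U v by exact: open_nbhs_nbhs.
  rewrite (near_shift 0) subr0.
  by apply: filterS => h /=; rewrite addrC.
near=> h.
have Uzh : U (z + h) by near: h.
have hcover : `[0, 1] `<=` [set t : R |
    `|f (y + t *: (z - y) + t *: h) - f (y + t *: (z - y)) -
      lincomb (fun i => partial i f (y + t *: (z - y))) (t *: h)| <= e * `|t *: h|].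
  by near: h.
have [cs Is] := integral01_sum (fun i => h 0 i)
  (fun i => @continuous01_ray _ z k.+1 (cdf i) Uz).
have cz := @continuous01_ray f z k cf Uz.
have czh := @continuous01_ray f (z + h) k cf Uzh.
rewrite -[X in _ - X]/(lincomb a h).
have -> : lincomb a h = integral01 (fun t => \sum_i h 0 i *
    (t ^+ k.+1 * partial i f (y + t *: (z - y)))) by rewrite Is.
rewrite [X in `|X - _|]addrC -[X in `|X + _ - _|]mulN1r -integral01_lin //.
rewrite addrC -[X in `|X + _|]mulN1r -integral01_lin //; last exact: continuous01_lin.
apply: integral01_le => [|t t01]; first by do 2 apply: continuous01_lin => //.
rewrite !mulN1r.
have -> : \sum_i h 0 i * (t ^+ k.+1 * partial i f (y + t *: (z - y))) =
    t ^+ k * lincomb (fun i => partial i f (y + t *: (z - y))) (t *: h).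
  by rewrite /lincomb mulr_sumr; apply: eq_bigr => i _; rewrite !mxE exprS; ring.
rewrite addrC [- _ + _]addrC -!mulrBr.
rewrite (_ : y + t *: (z + h - y) = y + t *: (z - y) + t *: h); last first.
  by rewrite -[RHS]addrA -scalerDr [z - y + h]addrAC.
have /andP[t0 t1] : 0 <= t <= 1 by move: t01; rewrite in_itv.
rewrite normrM normrX ger0_norm //.
apply: le_trans (_ : 1 * (e * `|t *: h|) <= _).
  by apply: ler_pM => //; [exact: exprn_ge0|exact: exprn_ile1|exact: hcover].
rewrite mul1r normrZ ger0_norm //.
by apply: ler_wpM2l; [exact: ltW|rewrite ler_piMl].
Unshelve. all: by end_near. Qed.

Lemma ray_integral_smooth f k : smooth_on U f -> smooth_on U (ray_integral y k f).
Proof.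
move=> sf s x Ux; apply: (_ : diff_upto U (size s) _) => // {x Ux}.
elim: (size s) k f sf => [|m IHm] k f sf.
  move=> [|//] x _ Ux; apply: (ray_integral_differentiable _ _ _ Ux).1.
  - by move=> v; exact: (sf [::]).
  - by move=> i v Uv; apply: differentiable_continuous; exact: (sf [:: i]).
have dJ z Uz := @ray_integral_differentiable f z k (sf [::])
  (fun i v Uv => differentiable_continuous (sf [:: i] v Uv)) Uz.
apply: diff_uptoS => [z /dJ[]//|i].
apply: (@diff_upto_eq _ _ _ U oU _ (ray_integral y k.+1 (partial i f))).
  by move=> z; rewrite inE => /dJ[_ ->].
by apply: IHm => r; exact: (sf (i :: r)).
Qed.

(** The fundamental theorem of calculus on the segment from y to z. *)
Lemma hadamard f z : smooth_on U f -> U z ->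
  f z - f y = \sum_i (z 0 i - y 0 i) * ray_integral y 0 (partial i f) z.
Proof.
move=> sf Uz.
have cdf i v : U v -> {for v, continuous (partial i f)}.
  by move=> Uv; apply: differentiable_continuous; exact: (sf [:: i]).
have [cs Is] := integral01_sum (fun i => z 0 i - y 0 i)
  (fun i => @continuous01_ray _ z 0 (cdf i) Uz).
have dF (t : R) : t \in `[0, 1]%R ->
    is_derive t 1 (fun t : R => f (y + t *: (z - y)))
      (\sum_i (z 0 i - y 0 i) * (t ^+ 0 * partial i f (y + t *: (z - y)))).
  move=> t01; have Ut := sU Uz t01.
  have := is_derive_line (sf [::] _ Ut).
  rewrite derive_lincomb; last exact: (sf [::]).
  congr (is_derive _ _ _ _); apply: eq_bigr => i _.
  by rewrite !mxE expr0 mul1r.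
by rewrite -Is (integral01_FTC cs dF) scale1r scale0r addr0 subrKC.
Qed.

Lemma ray_integral_centre f : ray_integral y 0 f y = f y.
Proof.
rewrite /ray_integral -[RHS]integral01_cst; congr integral01.
by apply/funext => t; rewrite subrr scaler0 addr0 expr0 mul1r.
Qed.

End AtCentre.

End RayIntegral.

(** * Smooth functions of several variables and bump functions *)

Section SmoothComposition.
Context {R : realType} {n : nat}.
Implicit Types (U W : set 'rV[R]_n) (f g : 'rV[R]_n -> R).
Local Notation partial i f := ('D_(delta_mx 0 i) f).

Lemma smooth_on_eq U f g : open U -> {in U, f =1 g} ->
  smooth_on U f -> smooth_on U g.
Proof.
move=> oU fg sf s x Ux.
by apply: (diff_upto_eq oU fg (k := size s)) => // t y _; exact: sf.
Qed.

Lemma smooth_onS (V : normedModType R) U W (f : 'rV[R]_n -> V) : U `<=` W ->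
  smooth_on W f -> smooth_on U f.
Proof. by move=> UW sf s x /UW; exact: sf. Qed.

Lemma diff_upto_sum U k m (F : 'I_m -> 'rV[R]_n -> R) : open U ->
  (forall j, diff_upto U k (F j)) -> diff_upto U k (fun x => \sum_j F j x).
Proof.
move=> oU dF; elim: (index_enum _) => [|j r IHr].
  apply: (diff_upto_eq oU (f := cst 0)) => [x _|]; first by rewrite big_nil.
  by move=> s x _ Ux; exact: (@smooth_on_cst _ _ _ U).
apply: (diff_upto_eq oU (f := 1 *: F j + fun x => \sum_(i <- r) F i x)).
  by move=> x _; rewrite big_cons scale1r.
exact: diff_upto_lin.
Qed.

Lemma diff_upto_coord U k m (P : 'rV[R]_n -> 'rV[R]_m) j : open U ->
  diff_upto U k P -> diff_upto U k (fun x => P x 0 j).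
Proof.
move=> oU; have dC (Q : 'rV[R]_n -> 'rV[R]_m) x : differentiable Q x ->
    differentiable (fun x => Q x 0 j) x.
  move=> dQ; apply: (differentiable_comp (g := fun M : 'rV[R]_m => M 0 j)) => //.
  exact: differentiable_coord.
elim: k P => [|k IHk] P dP.
  by move=> [|//] x _ Ux; apply: dC; exact: (dP [::]).
apply: diff_uptoS => [x Ux|i]; first by apply: dC; exact: (dP [::]).
apply: (@diff_upto_eq _ _ _ U oU _ (fun x => partial i P x 0 j)).
  move=> x; rewrite inE => Ux; rewrite derive_mx ?mxE //.
  by apply: diff_derivable; exact: (dP [::]).
exact/IHk/diff_upto_partial.
Qed.

(** By the chain rule the partial derivatives of f \o P are sums of products of
coordinates of partial derivatives of P with functions g \o P, where g is again
smooth; the induction is on the number of derivatives. *)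
Lemma smooth_on_comp m U (W : set 'rV[R]_m) (P : 'rV[R]_n -> 'rV[R]_m)
    (f : 'rV[R]_m -> R) : open U -> (forall x, U x -> W (P x)) ->
  smooth_on U P -> smooth_on W f -> smooth_on U (f \o P).
Proof.
move=> oU PW sP sf s x Ux; apply: (_ : diff_upto U (size s) _) => // {x Ux}.
have dP k : diff_upto U k P by move=> r x _; exact: sP.
elim: (size s) f sf => [|k IHk] f sf.
  move=> [|//] x _ Ux; apply: differentiable_comp; first exact: (dP 0%N [::]).
  by apply: (sf [::]); exact: PW.
apply: diff_uptoS => [x Ux|i].
  apply: differentiable_comp; first exact: (dP 0%N [::]).
  by apply: (sf [::]); exact: PW.
apply: (@diff_upto_eq _ _ _ U oU _ (fun x => \sum_j
    (((fun x => partial i P x 0 j) : 'rV[R]_n -> R) * (partial j f \o P)) x)).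
  move=> x; rewrite inE => Ux.
  have dPx : differentiable P x by exact: (dP 0%N [::]).
  have dfP : differentiable f (P x) by apply: (sf [::]); exact: PW.
  rewrite [in RHS]deriveE; last exact: differentiable_comp.
  rewrite diff_comp //= -!deriveE // derive_lincomb //.
apply: diff_upto_sum => // j; apply: diff_uptoM => //.
  by apply: diff_upto_coord => //; exact: diff_upto_partial.
by apply: IHk => r; exact: (sf (j :: r)).
Qed.

Lemma smooth_on_coord U (i : 'I_n) : open U -> smooth_on U (fun z => z 0 i).
Proof.
move=> oU [|j s] x Ux /=; first exact: differentiable_coord.
have E : partial j (fun z : 'rV[R]_n => z 0 i) =
    cst ((delta_mx 0 j : 'rV[R]_n) 0 i).
  apply/funext => y.
  have /matrixP/(_ 0 i) := derive_mx (@derivable_id _ _ y (delta_mx 0 j : 'rV[R]_n)).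
  by rewrite mxE derive_id => <-.
by rewrite E; exact: (@smooth_on_cst _ _ _ U).
Qed.

Lemma smooth_on_prod U m (F : 'I_m -> 'rV[R]_n -> R) : open U ->
  (forall j, smooth_on U (F j)) -> smooth_on U (fun x => \prod_j F j x).
Proof.
move=> oU sF; elim: (index_enum _) => [|j r IHr].
  by under eq_fun do rewrite big_nil; exact: smooth_on_cst.
by under eq_fun do rewrite big_cons; exact: (smooth_onM oU (sF j)).
Qed.

End SmoothComposition.

Section FlatFunction.
Context {R : realType}.

(** t ^- m exp(- 1 / t) on the positive half-line.  The derivative of a member of
this family is a combination of members, which gives the smoothness of all of
them together; only m = 0 is wanted. *)
Definition flat (m : nat) (t : R) : R :=
  if 0 < t then t ^- m * expR (- t^-1) else 0.

(** The exponential series bounds exp(1 / t) below by (1 / t) ^ (m + 1) / (m + 1)!. *)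
Lemma flat_le m (t : R) : `|flat m t| <= m.+1`!%:R * `|t|.
Proof.
rewrite /flat; case: ifPn => [t0|_]; last by rewrite normr0 mulr_ge0.
rewrite !gtr0_norm //; last by rewrite mulr_gt0 ?expR_gt0 // invr_gt0 exprn_gt0.
rewrite expRN ler_pdivrMr ?expR_gt0 // mulrC.
have := expR_ge1Dxn m (ltW (_ : 0 < t^-1)); rewrite invr_gt0 => /(_ t0) H.
have {}H : t^-1 ^+ m.+1 / m.+1`!%:R <= expR t^-1.
  by apply: le_trans H; rewrite lerDr.
rewrite ler_pdivrMr ?ltr0n ?fact_gt0 // in H.
have: t * t^-1 ^+ m.+1 <= t * (expR t^-1 * m.+1`!%:R) by rewrite ler_pM2l.
rewrite exprS mulVKf ?gt_eqF // exprVn => /le_trans; apply.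
by rewrite le_eqVlt; apply/orP; left; apply/eqP; ring.
Qed.

Lemma flat_cvg0 m : flat m t @[t --> (0 : R)] --> (0 : R).
Proof.
apply/cvgr0Pnorm_le => e e0; have F0 : 0 < (m.+1`!%:R : R) by rewrite ltr0n fact_gt0.
have H : \forall t \near (0 : R), `|t| <= e / m.+1`!%:R.
  by apply: nbhs0_le; rewrite divr_gt0.
near=> t; apply: le_trans (flat_le m t) _.
rewrite mulrC -ler_pdivlMr //; near: t.
exact: H.
Unshelve. all: by end_near. Qed.

(** At 0 the difference quotient of flat m is flat m.+1, which tends to 0. *)
Lemma flat_derive m (t : R) :
  is_derive t 1 (flat m) (flat m.+2 t - m%:R * flat m.+1 t).
Proof.
have [t0|t0|->] := ltgtP t 0.
- rewrite /flat !ltNge (ltW t0) /= mulr0 subrr.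
  apply: (near_eq_is_derive (f := cst 0)) => //.
  by near=> s; rewrite /flat ltNge ltW //=; near: s; exact: lt_nbhsl.
- have E k : flat k t = t ^- k * expR (- t^-1) by rewrite /flat t0.
  rewrite !E.
  apply: (near_eq_is_derive (f := fun s : R => (s ^+ m)^-1 * expR (- s^-1))).
    by near=> s; rewrite /flat ifT //; near: s; exact: lt_nbhsr.
  have tm : t ^+ m != 0 by rewrite expf_neq0 // gt_eqF.
  have tn : t != 0 by rewrite gt_eqF.
  have dX : is_derive t 1 (fun s : R => s ^+ m) ((m%:R * t ^+ m.-1) *: 1).
    rewrite (_ : (fun s : R => s ^+ m) = id ^+ m); first exact: is_deriveX.
    by apply/funext => s; rewrite exprfctE.
  have d1 := is_deriveV (f := fun s : R => s ^+ m) tm dX.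
  have d2 := is_deriveV (f := id) tn (is_derive_id t (1 : R)).
  have d3 := is_derive1_comp (g := fun s : R => - s^-1)
    (is_derive_expR (- t^-1)) (is_deriveN d2).
  refine (is_derive_eq (is_deriveM d1 d3) _).
  rewrite /= -![_ *: _]/(_ * _) !mulr1 opprK.
  case: m tm {dX d1 d2 d3} => [|m] tm.
    by rewrite !mul0r mulr0 /=; field.
  have tm1 : t ^+ m != 0 by rewrite expf_neq0.
  by rewrite /= !exprS; field; rewrite tn tm1.
- rewrite /flat ltxx /= mulr0 subrr.
  have lim0 : (fun h => h^-1 *: ((flat m \o shift 0) (h *: 1) - flat m 0)) @ 0^'
      --> (0 : R).
    have F0 : flat m.+1 h @[h --> (0 : R)^'] --> (0 : R).
      by apply: cvg_within_filter; exact: flat_cvg0.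
    apply: cvg_trans F0; apply: near_eq_cvg; near=> h.
    have h0 : h != 0 by near: h; exact: nbhs_dnbhs_neq.
    rewrite /= addr0 scaler1 /flat ltxx subr0; case: ifPn => _; last by rewrite scaler0.
    rewrite -[_ *: _]/(_ * _) exprS; field.
    by rewrite h0 expf_neq0.
  by split; [apply/cvg_ex; exists 0|exact: cvg_lim].
Unshelve. all: by end_near. Qed.

Lemma diff_upto_flat n (U : set 'rV[R]_n) k (q : 'rV[R]_n -> R) m : open U ->
  diff_upto U k q -> diff_upto U k (flat m \o q).
Proof.
move=> oU dq.
have dF m' x : differentiable q x -> differentiable (flat m' \o q) x.
  move=> dqx; apply: differentiable_comp => //.
  by apply/derivable1_diffP; have [] := flat_derive m' (q x).
elim: k m dq => [|k IHk] m dq.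
  by move=> [|//] x _ Ux; apply: dF; exact: (dq [::]).
apply: diff_uptoS => [x Ux|i]; first by apply: dF; exact: (dq [::]).
pose psi := - m%:R *: (flat m.+1 \o q) + (flat m.+2 \o q).
apply: (@diff_upto_eq _ _ _ U oU _ (psi * 'D_(delta_mx 0 i) q)).
  move=> x; rewrite inE => Ux.
  have dqx : differentiable q x by exact: (dq [::]).
  have dfx : differentiable (flat m) (q x).
    by apply/derivable1_diffP; have [] := flat_derive m (q x).
  rewrite [RHS]deriveE; last exact: dF.
  have [dfl fE] := flat_derive m (q x).
  rewrite diff_comp //= deriv1E // derive1E fE -deriveE // mulrC; congr (_ * _).
  by rewrite addrC -mulNr.
have dq' := diff_upto_le (leqnSn k) dq.
apply: diff_uptoM => //; last exact: diff_upto_partial.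
by apply: diff_upto_lin => //; exact: IHk.
Qed.


Lemma smooth_on_flat n (U : set 'rV[R]_n) (q : 'rV[R]_n -> R) m : open U ->
  smooth_on U q -> smooth_on U (flat m \o q).
Proof.
move=> oU sq s x Ux; apply: (diff_upto_flat m oU (k := size s)) => // r y _.
exact: sq.
Qed.

Context {n : nat}.

(** A product over the coordinates, because balls are those of the sup norm. *)
Definition bump (a : 'rV[R]_n) (r : R) (z : 'rV[R]_n) : R :=
  \prod_i flat 0 (r ^+ 2 - (z 0 i - a 0 i) ^+ 2).

Lemma bump_smooth a r U : open U -> smooth_on U (bump a r).
Proof.
move=> oU; apply: smooth_on_prod => // i.
pose q (z : 'rV[R]_n) : R := z 0 i - a 0 i.
have sq : smooth_on U q.
  rewrite (_ : q = 1 *: (fun z : 'rV[R]_n => z 0 i) + cst (- a 0 i)); last first.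
    by apply/funext => z; rewrite scale1r.
  by apply: smooth_on_lin => //; [exact: smooth_on_coord|exact: smooth_on_cst].
apply: (@smooth_on_flat _ _ (fun z => r ^+ 2 - q z ^+ 2)) => //.
rewrite (_ : (fun z => _) = -1 *: (q * q) + cst (r ^+ 2)); last first.
  by apply/funext => z; rewrite scaleN1r addrC.
by apply: smooth_on_lin => //; [exact: smooth_onM|exact: smooth_on_cst].
Qed.

Lemma bump_gt0 a r z : 0 < r -> (`|a - z| < r) = (0 < bump a r z).
Proof.
move=> r0.
have flat0 t : (0 < flat 0 t) = (0 < t).
  rewrite /flat; case: ifP; last by rewrite ltxx.
  by rewrite expr0 invr1 mul1r expR_gt0.
have flatge t : 0 <= flat 0 t.
  by rewrite /flat; case: ifP => // _; rewrite expr0 invr1 mul1r expR_ge0.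
have E i : (0 < r ^+ 2 - (z 0 i - a 0 i) ^+ 2) = (`|a 0 i - z 0 i| < r).
  rewrite subr_gt0 -real_normK ?num_real // distrC.
  by rewrite ltr_pXn2r ?nnegrE // ltW.
apply/idP/idP => [azr|].
  apply: prodr_gt0 => i _; rewrite flat0 E.
  by apply: le_lt_trans azr; have := normr_coord (a - z) i; rewrite !mxE.
apply: contraTT; rewrite -!leNgt => raz.
suff [i Hi] : exists i, r <= `|a 0 i - z 0 i|.
  rewrite /bump (bigD1 i) //= {1}/flat E ltNge Hi /= mul0r //.
apply/existsP; apply: contraTT raz; rewrite negb_exists -ltNge => /forallP H.
rewrite [ltLHS]/Num.norm /= mx_normrE.
apply/bigmax_ltP; split => // -[j i] _ /=.
by have := H i; rewrite -ltNge !mxE (ord1 j).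
Qed.

End FlatFunction.

(** * Functions on a manifold supported in a chart *)

Section ChartExtension.
Context {R : realType} {n : nat} (M : manifold R n).
Implicit Types (c d : chart R n M).
Local Notation image c := (chart_map c @` chart_dom c).

Lemma atlas_compatible c d : atlas c -> atlas d -> compatible_charts c d.
Proof. by case: M c d => T A ? ? ? H c d; exact: H. Qed.

Lemma atlas_cover (p : M) : exists2 c, atlas c & chart_dom c p.
Proof.
case: M p => T A ? ? H ? p /=; have : setT p by [].
by rewrite -H => -[c Ac Dp]; exists c.
Qed.

Lemma chart_imageP c z : image c z -> chart_dom c (chart_inv c z) /\
  chart_map c (chart_inv c z) = z.
Proof.
case: c => dom map inv _ _ mapK _ _ /= [q Dq <-].
by rewrite mapK // inE.
Qed.

Lemma chart_mapK c q : chart_dom c q -> chart_inv c (chart_map c q) = q.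
Proof. by case: c => dom map inv /= _ _ mapK _ _ Dq; rewrite mapK // inE. Qed.

Lemma chart_image_open c : open (image c).
Proof. by case: c. Qed.

Lemma chart_dom_open c : open (chart_dom c).
Proof. by case: c. Qed.

Lemma chart_preimage_open c (O : set M) : open O ->
  open [set z | image c z /\ O (chart_inv c z)].
Proof.
move=> oO; rewrite openE => z [Wz Oz].
have cinv : {for z, continuous (chart_inv c)}.
  case: c Wz {Oz} => dom map inv /= _ oW _ _.
  by rewrite continuous_open_subspace // => H Wz; apply: H; rewrite inE.
have nW := open_nbhs_nbhs (conj (@chart_image_open c) Wz).
have nO := cinv _ (open_nbhs_nbhs (conj oO Oz)).
exact: filterI nW nO.
Qed.

(** This is where the separation of M is used: without it, extending by zero a
function supported in a chart may create a discontinuity. *)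
Lemma chart_inv_compact_closed c (K : set 'rV[R]_n) : compact K ->
  K `<=` image c -> closed (chart_inv c @` K).
Proof.
move=> cK KW; apply: compact_closed; first by case: M.
apply: continuous_compact => //.
case: c KW => dom map inv /= _ _ _ _ cinv KW.
exact: continuous_subspaceW cinv.
Qed.

Definition chart_ext c (g : 'rV[R]_n -> R) (q : M) : R :=
  if `[< chart_dom c q >] then g (chart_map c q) else 0.

Lemma chart_extE c g q : chart_dom c q -> chart_ext c g q = g (chart_map c q).
Proof. by move=> Dq; rewrite /chart_ext asboolT. Qed.

Lemma chart_ext_out c g q : ~ chart_dom c q -> chart_ext c g q = 0.
Proof. by move=> Dq; rewrite /chart_ext asboolF. Qed.

(** A point outside the chart has a neighbourhood that avoids the compact, hence
closed, image in M of the ball of radius r; there the extension is zero.  At the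
other points one composes with a change of charts.  The function g need be smooth
only on a ball somewhat larger than the one outside which it vanishes. *)
Lemma chart_ext_smooth c (a : 'rV[R]_n) (r : R) g : atlas c -> 0 < r ->
  ball a (r + r) `<=` image c -> smooth_on (ball a (r + r)) g ->
  (forall z, ~ ball a r z -> g z = 0) -> smooth (chart_ext c g).
Proof.
move=> Ac r0 bW sg g0.
pose K := [set z : 'rV[R]_n | `|a - z| <= r].
have Kb : K `<=` ball a (r + r).
  by move=> z /le_lt_trans H; rewrite -ball_normE /=; apply: H; rewrite ltrDl.
have clK : closed K.
  have cN : continuous (fun z : 'rV[R]_n => `|a - z|).
    move=> z; apply: continuous_comp; last exact: norm_continuous.
    by apply: continuousB; [exact: cst_continuous|exact: cvg_id].
  by apply: (closed_comp (f := fun z : 'rV[R]_n => `|a - z|)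
    (D := [set s | s <= r])).
have cK : compact K.
  apply: bounded_closed_compact => //.
  exists (`|a| + r); split; first exact: num_real.
  move=> s sar z Kz /=; apply: le_trans (ltW sar).
  rewrite -[z](subKr a); apply: le_trans (ler_normB _ _) _.
  by rewrite lerD2l.
have gK z : ~ K z -> g z = 0.
  by move=> Kz; apply: g0 => bz; apply: Kz; move: bz; rewrite -ball_normE => /ltW.
have KW := subset_trans Kb bW.
(* off the closed ball of radius r, g is locally zero *)
have sgW : smooth_on (image c) g.
  move=> s z Wz; have [Kz|Kz] := pselect (K z); first exact/sg/Kb.
  have oO : open (~` K) by exact: closed_openC.
  apply: (@smooth_on_eq _ _ (~` K) (cst 0)) => //; last exact: smooth_on_cst.
  by move=> v; rewrite inE => /gK.
have clKM := chart_inv_compact_closed cK KW.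
move=> d Ad s z0 Wz0; have [Dq Ez0] := chart_imageP Wz0.
have [Cq|Cq] := pselect (chart_dom c (chart_inv d z0)).
  pose V := [set z | image d z /\ chart_dom c (chart_inv d z)].
  have oV : open V by apply: chart_preimage_open; exact: chart_dom_open.
  apply: (@smooth_on_eq _ _ V (g \o (chart_map c \o chart_inv d))) => //.
    by move=> z; rewrite inE => -[Wz Dz] /=; rewrite chart_extE.
  apply: (smooth_on_comp (W := image c)) => //.
    by move=> z [_ Dz] /=; exists (chart_inv d z).
  have compat := atlas_compatible Ad Ac.
  move: compat; rewrite /compatible_charts; congr smooth_on.
  rewrite eqEsubset; split => z.
    by move=> [q [Dq' Cq'] <-]; split; [exists q|rewrite chart_mapK].
  by move=> [/chart_imageP[Dz Ez] Cz]; exists (chart_inv d z).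
pose V := [set z | image d z /\ (~` (chart_inv c @` K)) (chart_inv d z)].
have oV : open V by apply: chart_preimage_open; exact: closed_openC.
apply: (@smooth_on_eq _ _ V (cst 0)) => //; [|exact: smooth_on_cst|].
  move=> z; rewrite inE => -[Wz Kz] /=.
  have [Cz|Cz] := pselect (chart_dom c (chart_inv d z)); last by rewrite chart_ext_out.
  rewrite chart_extE // gK // => Kc; apply: Kz.
  by exists (chart_map c (chart_inv d z)); rewrite // chart_mapK.
split=> // -[z /KW/chart_imageP[Dz _] Ez]; apply: Cq.
by rewrite -Ez.
Qed.

End ChartExtension.

(** * Vector fields as derivations *)

Section Derivations.
Context {R : realType} {n : nat} {M : manifold R n}.
Local Notation C := (smoothfun M).
Implicit Types (X Y : vfield M) (f g : C).

Lemma smoothfun_ext f g : (forall q, f q = g q) -> f = g.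
Proof. by move=> fg; apply/val_inj/funext. Qed.

Lemma smoothfunD f g q : (f + g) q = f q + g q. Proof. by []. Qed.
Lemma smoothfunN f q : (- f) q = - f q. Proof. by []. Qed.
Lemma smoothfunM f g q : (f * g) q = f q * g q. Proof. by []. Qed.
Lemma smoothfunZ (a : R) f q : (a *: f) q = a * f q. Proof. by []. Qed.
Lemma smoothfun1 q : (1 : C) q = 1. Proof. by []. Qed.

Lemma smoothfun_sum (I : Type) (r : seq I) (F : I -> C) q :
  (\sum_(i <- r) F i) q = \sum_(i <- r) F i q.
Proof. by elim: r => [|i r IHr]; rewrite ?big_nil // !big_cons -IHr. Qed.

Lemma derivation_lin X (a : R) f g : X (a *: f + g) = a *: X f + X g.
Proof. by have [Xl _] := vfieldP X; rewrite Xl. Qed.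

Lemma derivationD X f g : X (f + g) = X f + X g.
Proof. by rewrite -[f in LHS]scale1r derivation_lin scale1r. Qed.

Lemma derivation0 X : X 0 = 0.
Proof. by apply: (addIr (X 0)); rewrite -derivationD addr0 add0r. Qed.

Lemma derivationZ X (a : R) f : X (a *: f) = a *: X f.
Proof. by rewrite -[_ *: f]addr0 derivation_lin derivation0 addr0. Qed.

Lemma derivationN X f : X (- f) = - X f.
Proof. by rewrite -scaleN1r derivationZ scaleN1r. Qed.

Lemma derivationB X f g : X (f - g) = X f - X g.
Proof. by rewrite derivationD derivationN. Qed.

Lemma derivationM X f g : X (f * g) = X f * g + f * X g.
Proof. by have [_ XM] := vfieldP X; rewrite XM. Qed.

Lemma derivation_sum X (I : Type) (r : seq I) (F : I -> C) :
  X (\sum_(i <- r) F i) = \sum_(i <- r) X (F i).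
Proof.
by elim: r => [|i r IHr]; rewrite ?big_nil ?derivation0 // !big_cons derivationD IHr.
Qed.

Lemma derivation1 X : X 1 = 0.
Proof.
have := derivationM X 1 1; rewrite !mul1r mulr1 => /esym/eqP.
by rewrite -subr_eq0 addrK => /eqP.
Qed.

Lemma vfield_ext X Y : (forall f, X f = Y f) -> X = Y.
Proof. by move=> XY; apply/val_inj/funext. Qed.


End Derivations.

(** * Local frames of the tangent bundle *)

Section LocalFrame.
Context {R : realType} {n : nat} (M : manifold R n).
Local Notation C := (smoothfun M).
Local Notation image c := (chart_map c @` chart_dom c).
Local Notation partial i f := ('D_(delta_mx 0 i) f).

Lemma smoothfun_chart (f : C) (c : chart R n M) : atlas c ->
  smooth_on (image c) (f \o chart_inv c).
Proof. by move=> Ac; have /asboolP := valP f; exact. Qed.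

Lemma smooth_on_partial (U : set 'rV[R]_n) (F : 'rV[R]_n -> R) i :
  smooth_on U F -> smooth_on U (partial i F).
Proof. by move=> sF s; exact: (sF (i :: s)). Qed.

Lemma ball_star_shaped (a y : 'rV[R]_n) (r : R) :
  ball a r y -> star_shaped y (ball a r).
Proof.
rewrite -ball_normE /= => ay z s /= az; rewrite in_itv /= => /andP[s0 s1].
have -> : a - (y + s *: (z - y)) = (1 - s) *: (a - y) + s *: (a - z).
  by apply/matrixP => i j; rewrite !mxE; ring.
apply: le_lt_trans (ler_normD _ _) _; rewrite !normrZ !ger0_norm ?subr_ge0 //.
have [s0'|s0'] := eqVneq s 0; first by rewrite s0' subr0 mul1r mul0r addr0.
have sp : 0 < s by rewrite lt_def s0' s0.
have h1 : s * `|a - z| < s * r by rewrite ltr_pM2l.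
have h2 : (1 - s) * `|a - y| <= (1 - s) * r by rewrite ler_wpM2l ?subr_ge0 // ltW.
by have := ler_ltD h2 h1; rewrite -mulrDl subrK mul1r.
Qed.

Section InChart.
Variables (c : chart R n M) (a : 'rV[R]_n) (r : R).
Hypotheses (Ac : atlas c) (r0 : 0 < r) (bW : ball a (r + r) `<=` image c).
Let W := ball a (r + r).
Let theta := bump a r.

Let oW : open W. Proof. exact: ball_open. Qed.

Lemma bump_out z : ~ ball a r z -> theta z = 0.
Proof.
move=> bz; apply/eqP; rewrite eq_le prodr_ge0 ?andbT.
  by rewrite leNgt -bump_gt0 //; apply/negP => H; apply: bz; rewrite -ball_normE.
by move=> i _; rewrite /flat; case: ifP => // _; rewrite expr0 invr1 mul1r expR_ge0.
Qed.

Lemma cutoff_subproof (F : 'rV[R]_n -> R) : smooth_on W F ->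
  chart_ext c (fun z => theta z * F z) \in @smooth_pred R n M.
Proof.
move=> sF; apply/asboolP; apply: (@chart_ext_smooth _ _ _ c a r) => //.
  by apply: (@smooth_onM _ _ _ theta F) => //; exact: bump_smooth.
by move=> z /bump_out ->; rewrite mul0r.
Qed.

(** The Hadamard quotients of a function are defined only on a ball of the chart,
hence F is not required to be smooth on the whole image of the chart. *)
Definition cutoff F (sF : smooth_on W F) : C := SmoothFun (cutoff_subproof sF).

Let sW (f : C) : smooth_on W (f \o chart_inv c).
Proof. exact: smooth_onS bW (smoothfun_chart f Ac). Qed.

Lemma cutoff_cases (q : M) :
  (forall F (sF : smooth_on W F), cutoff sF q = 0) \/
  [/\ chart_dom c q, ball a r (chart_map c q) &
    forall F (sF : smooth_on W F),
      cutoff sF q = theta (chart_map c q) * F (chart_map c q)].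
Proof.
have [Dq|Dq] := pselect (chart_dom c q); last first.
  by left=> F sF; rewrite /= chart_ext_out.
have [bq|bq] := pselect (ball a r (chart_map c q)); last first.
  by left=> F sF; rewrite /= chart_extE // bump_out // mul0r.
by right; split=> // F sF; rewrite /= chart_extE.
Qed.

Let rW : ball a r `<=` W.
Proof. by apply: le_ball; rewrite lerDl ltW. Qed.

Lemma coord_derivation_subproof i : (fun f : C =>
  cutoff (smooth_on_partial i (sW f))) \in @derivation R n M.
Proof.
have df (h : C) z : W z -> derivable (h \o chart_inv c) z (delta_mx 0 i).
  by move=> Wz; apply: diff_derivable; exact: (sW h [::]).
apply/asboolP; split => [k f g|f g]; apply: smoothfun_ext => q.
  rewrite smoothfunD smoothfunZ.
  case: (cutoff_cases q) => [E|[Dq /rW Wz E]]; rewrite !E ?mulr0 ?addr0 //.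
  set z := chart_map c q in Wz *.
  rewrite (_ : ((k *: f + g : C) : M -> R) \o chart_inv c =
     k *: (f \o chart_inv c) + (g \o chart_inv c)) //.
  rewrite deriveD; [|exact/derivableZ/df|exact: df].
  rewrite deriveZ; last exact: df.
  by rewrite mulrDr mulrCA.
rewrite smoothfunD !smoothfunM.
case: (cutoff_cases q) => [E|[Dq /rW Wz E]]; rewrite !E ?mulr0 ?mul0r ?addr0 //.
set z := chart_map c q in Wz *.
rewrite (_ : ((f * g : C) : M -> R) \o chart_inv c =
   (f \o chart_inv c) * (g \o chart_inv c)) // deriveM; [|exact: df..].
have Ez (h : C) : (h \o chart_inv c) z = h q by rewrite /= /z chart_mapK.
by rewrite !Ez -![_ *: _]/(_ * _); ring.
Qed.

(** theta d/dz_i. *)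
Definition coord_derivation i : vfield M := VField (coord_derivation_subproof i).

Let one_smooth : smooth_on W (cst (1 : R)). Proof. exact: smooth_on_cst. Qed.

(** Let q have coordinates y.  Hadamard's lemma at y, multiplied by theta^2,
reads t^2 (f - f q) = sum_i (x_i - y_i t) G_i, where f - f q and all x_i - y_i t
vanish at q.  Applying X and evaluating at q leaves only the terms in which these
functions are differentiated; multiplying by t, where t(q) y_i = x_i(q), gives the
claim.  As x_i = t z_i, the coefficient t X(x_i) - x_i X(t) is t^2 X(z_i), written
without the coordinate z_i, which is not a function on M. *)
Lemma coord_derivation_frame (X : vfield M) (f : C) :
  let t := cutoff one_smooth in
  let x i := cutoff (smooth_on_coord i oW) in
  t ^+ 3 * X f = \sum_i (t * X (x i) - x i * X t) * coord_derivation i f.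
Proof.
move=> t x; apply: smoothfun_ext => q; rewrite smoothfun_sum.
case: (cutoff_cases q) => [E|[Dq bq E]].
  rewrite exprS !smoothfunM E !mul0r big1 // => i _.
  by rewrite smoothfunM smoothfunD smoothfunN !smoothfunM !E !mul0r subr0 mul0r.
have Wq := rW bq; set y := chart_map c q in bq Wq E.
have star : star_shaped y W by exact: ball_star_shaped.
pose F := f \o chart_inv c.
have sG i : smooth_on W (ray_integral y 0 (partial i F)).
  by apply: ray_integral_smooth => //; apply: smooth_on_partial; exact: sW.
pose G i := cutoff (sG i).
have H : t ^+ 2 * (f - f q *: (1 : C)) = \sum_i (x i - y 0 i *: t) * G i.
  apply: smoothfun_ext => u; rewrite smoothfun_sum expr2 !smoothfunM.
  case: (cutoff_cases u) => [E'|[Du /rW Wu E']].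
    rewrite E' !mul0r big1 // => i _; rewrite smoothfunM E' mulr0 //.
  have Hf : f u - f q = \sum_i (chart_map c u 0 i - y 0 i) *
      ray_integral y 0 (partial i F) (chart_map c u).
    by rewrite -(hadamard star (sW f) Wu) /= chart_mapK // /y chart_mapK.
  rewrite smoothfunD smoothfunN smoothfunZ smoothfun1 mulr1 Hf !E' mulr_sumr.
  apply: eq_bigr => i _.
  rewrite smoothfunM smoothfunD smoothfunN smoothfunZ !E' /cst.
  ring.
have := congr1 (fun h : C => X h q) H; rewrite derivation_sum smoothfun_sum.
rewrite derivationM derivationB derivationZ derivation1 scaler0 subr0.
rewrite smoothfunD 2!smoothfunM [(f - _) q]smoothfunD smoothfunN smoothfunZ.
rewrite smoothfun1 mulr1 subrr mulr0 add0r => H1.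
rewrite exprS smoothfunM mulrAC -mulrA [X f q * _]mulrC H1 mulr_sumr.
apply: eq_bigr => i _.
rewrite derivationM derivationB derivationZ.
rewrite !(smoothfunM, smoothfunD, smoothfunN, smoothfunZ).
rewrite -[\val t q]/(t q) !E /cst !mulr1 ray_integral_centre /F.
ring.
Qed.

Lemma cutoff_one_neq0 (p : M) : chart_dom c p -> chart_map c p = a ->
  cutoff one_smooth p != 0.
Proof.
move=> Dp cpa; rewrite /= chart_extE // cpa mulr1 gt_eqF // -bump_gt0 //.
by rewrite subrr normr0.
Qed.

End InChart.


(** The factor t is a substitute for restricting derivations to an open set. *)
Theorem local_frame (p : M) : exists (t : C) (x : 'I_n -> C) (E : 'I_n -> vfield M),
  t p != 0 /\ forall (X : vfield M) (f : C),
    t ^+ 3 * X f = \sum_i (t * X (x i) - x i * X t) * E i f.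
Proof.
have [c Ac Dp] := atlas_cover p.
have Wp : image c (chart_map c p) by exists p.
have /nbhs_ballP[e /= e0 eW] := open_nbhs_nbhs (conj (@chart_image_open _ _ _ c) Wp).
have r0 : 0 < e / 2 by rewrite divr_gt0.
have bW : ball (chart_map c p) (e / 2 + e / 2) `<=` image c by rewrite -splitr.
do 3 eexists; split; last exact: (coord_derivation_frame Ac r0 bW).
exact: cutoff_one_neq0.
Qed.

End LocalFrame.

(** * One-forms *)

Section OneForms.
Context {R : realType} {n : nat} {M : manifold R n}.
Local Notation C := (smoothfun M).
Implicit Types (X Y : vfield M) (f g h : C) (al be : form1 M).

Lemma vfieldD X Y f : (X + Y) f = X f + Y f. Proof. by []. Qed.
Lemma vfieldZ h X f : (h *: X) f = h * X f. Proof. by []. Qed.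
Lemma form1D al be X : (al + be) X = al X + be X. Proof. by []. Qed.
Lemma form1Z h al X : (h *: al) X = h * al X. Proof. by []. Qed.
Lemma form1N al X : (- al) X = - al X. Proof. by []. Qed.

Lemma vfield_sum (I : Type) (r : seq I) (F : I -> vfield M) f :
  (\sum_(i <- r) F i) f = \sum_(i <- r) F i f.
Proof. by elim: r => [|i r IHr]; rewrite ?big_nil // !big_cons -IHr. Qed.

Lemma form1_sum (I : Type) (r : seq I) (F : I -> form1 M) X :
  (\sum_(i <- r) F i) X = \sum_(i <- r) F i X.
Proof. by elim: r => [|i r IHr]; rewrite ?big_nil // !big_cons -IHr. Qed.

Lemma form1_lin al h X Y : al (h *: X + Y) = h * al X + al Y.
Proof. by have /asboolP al_lin := valP al; rewrite [LHS]al_lin. Qed.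

Lemma form1_addr al X Y : al (X + Y) = al X + al Y.
Proof. by rewrite -[X in LHS]scale1r form1_lin mul1r. Qed.

Lemma form1_0r al : al 0 = 0.
Proof. by apply: (addIr (al 0)); rewrite -form1_addr addr0 add0r. Qed.

Lemma form1_scaler al h X : al (h *: X) = h * al X.
Proof. by rewrite -[_ *: X]addr0 form1_lin form1_0r addr0. Qed.

Lemma form1_sumr al (I : Type) (r : seq I) (F : I -> vfield M) :
  al (\sum_(i <- r) F i) = \sum_(i <- r) al (F i).
Proof.
by elim: r => [|i r IHr]; rewrite ?big_nil ?form1_0r // !big_cons form1_addr IHr.
Qed.

Lemma form1_ext al be : (forall X, al X = be X) -> al = be.
Proof. by move=> H; apply/val_inj/funext. Qed.

Lemma dform_subproof f : (fun X => X f) \in @is_form1 R n M.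
Proof. by apply/asboolP => h X Y. Qed.

Definition dform f : form1 M := Form1 (dform_subproof f).

Lemma dformE f X : dform f X = X f. Proof. by []. Qed.

Lemma dformM f g : dform (f * g) = g *: dform f + f *: dform g.
Proof. by apply: form1_ext => X; rewrite dformE derivationM mulrC. Qed.

Lemma dformD f g : dform (f + g) = dform f + dform g.
Proof. by apply: form1_ext => X; rewrite dformE derivationD. Qed.

Lemma smoothfun_local f g :
  (forall p, exists2 r : C, r p != 0 & r * f = r * g) -> f = g.
Proof.
move=> H; apply: smoothfun_ext => p; have [r rp /(congr1 (fun h : C => h p))] := H p.
by rewrite !smoothfunM => /(mulfI rp).
Qed.

(** The local frame, transposed. *)
Lemma local_coframe (p : M) : exists (t : C) (x : 'I_n -> C) (E : 'I_n -> vfield M),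
  t p != 0 /\
  forall al, t ^+ 3 *: al = \sum_i al (E i) *: (t *: dform (x i) - x i *: dform t).
Proof.
have [t [x [E [tp H]]]] := local_frame p; exists t, x, E; split=> // al.
apply: form1_ext => X; rewrite form1Z -form1_scaler form1_sum.
have -> : t ^+ 3 *: X = \sum_i (t * X (x i) - x i * X t) *: E i.
  by apply: vfield_ext => f; rewrite vfieldZ H vfield_sum.
rewrite form1_sumr; apply: eq_bigr => i _.
by rewrite form1_scaler form1Z form1D form1N !form1Z mulrC.
Qed.

(** The forms of a local coframe are combinations of differentials. *)
Lemma exact_span (F : form1 M -> C) :
  (forall h al be, F (h *: al + be) = h * F al + F be) ->
  (forall f, F (dform f) = 0) -> forall al, F al = 0.
Proof.
move=> Flin F0 al.
have FD be ga : F (be + ga) = F be + F ga by rewrite -[be in LHS]scale1r Flin mul1r.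
have FO : F 0 = 0 by apply: (addIr (F 0)); rewrite -FD addr0 add0r.
have FZ h be : F (h *: be) = h * F be by rewrite -[_ *: be]addr0 Flin FO addr0.
have FS (I : Type) (r : seq I) (G : I -> form1 M) :
    F (\sum_(i <- r) G i) = \sum_(i <- r) F (G i).
  by elim: r => [|i r IHr]; rewrite ?big_nil // !big_cons FD IHr.
apply: smoothfun_local => p; have [t [x [E [tp H]]]] := local_coframe p.
exists (t ^+ 3).
  by rewrite !exprS expr0 !smoothfunM smoothfun1 !mulf_neq0 // oner_neq0.
rewrite mulr0 -FZ H FS big1 // => i _.
by rewrite FZ -scaleNr FD !FZ !F0 !mulr0 addr0 mulr0.
Qed.

End OneForms.

(** * Exterior products in low degrees *)

Section Wedge.
Context {A : comPzRingType} {U : lmodType A}.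
Implicit Types (P Q : seq U -> A) (u v : U) (s t : seq U).

Definition of_degree (k : nat) P : Prop := forall s, size s != k -> P s = 0.

Lemma big_tuple_bool k (F : k.+1.-tuple bool -> A) :
  \sum_(m : k.+1.-tuple bool) F m =
  \sum_(m : k.-tuple bool) F [tuple of true :: m] +
  \sum_(m : k.-tuple bool) F [tuple of false :: m].
Proof.
rewrite (reindex (fun bm : bool * k.-tuple bool => [tuple of bm.1 :: bm.2])) /=.
  rewrite -(pair_bigA _ (fun b (m : k.-tuple bool) => F [tuple of b :: m])) /=.
  by rewrite big_bool.
exists (fun m : k.+1.-tuple bool => (thead m, [tuple of behead m])) => [[b m]|m] _ /=.
  by congr pair; apply: val_inj.
by rewrite [RHS]tuple_eta; apply: val_inj.
Qed.

Lemma wedge_nil P Q : wedge P Q [::] = P [::] * Q [::].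
Proof.
rewrite /wedge /= (bigD1 [tuple]) //= big1 => [|m /eqP[]]; last exact: tuple0.
by rewrite expr0 mul1r addr0.
Qed.

(** A shuffle either keeps u in front, or sends it to Q past the k arguments of
P, which costs the sign (-1) ^ k. *)
Lemma wedge_cons k P Q u s : of_degree k P ->
  wedge P Q (u :: s) =
  wedge (P \o cons u) Q s + (-1) ^+ k * wedge P (Q \o cons u) s.
Proof.
move=> hP; rewrite /wedge big_tuple_bool; congr (_ + _); rewrite mulr_sumr.
apply: eq_bigr => m _ /=.
have [mk|mk] := eqVneq (count id m) k; first by rewrite exprD mk mulrA.
by rewrite hP ?mul0r ?mulr0 // size_mask // size_tuple.
Qed.

Lemma wedge_congr P P' Q Q' s : P =1 P' -> Q =1 Q' -> wedge P Q s = wedge P' Q' s.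
Proof. by move=> PP QQ; apply: eq_bigr => m _; rewrite PP QQ. Qed.

Lemma wedge0l Q s : wedge (fun _ => 0) Q s = 0.
Proof. by rewrite /wedge big1 // => m _; rewrite mul0r mulr0. Qed.

Lemma of_degree_cons k P u : of_degree k.+1 P -> of_degree k (P \o cons u).
Proof. by move=> hP s sk; apply: hP. Qed.

Lemma wedge_deg0 P Q s : of_degree 0 P -> wedge P Q s = P [::] * Q s.
Proof.
move=> hP; elim: s Q => [|u s IHs] Q; first exact: wedge_nil.
rewrite (wedge_cons _ _ _ hP) expr0 mul1r IHs.
rewrite (@wedge_congr _ (fun _ => 0) _ Q) ?wedge0l ?add0r // => t /=.
exact: hP.
Qed.

Lemma wedge_deg11 P Q u v : of_degree 1 P ->
  wedge P Q [:: u; v] = P [:: u] * Q [:: v] - P [:: v] * Q [:: u].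
Proof.
move=> hP; rewrite (wedge_cons _ _ _ hP) (wedge_deg0 _ _ (of_degree_cons u hP)).
rewrite (wedge_cons _ _ _ hP) (wedge_deg0 _ _ (of_degree_cons v hP)).
by rewrite wedge_nil (hP [::]) // /=; ring.
Qed.

Lemma wedge_deg12 P Q u v w : of_degree 1 P -> of_degree 2 Q ->
  wedge P Q [:: u; v; w] =
  P [:: u] * Q [:: v; w] - P [:: v] * Q [:: u; w] + P [:: w] * Q [:: u; v].
Proof.
move=> hP hQ; rewrite (wedge_cons _ _ _ hP) (wedge_deg0 _ _ (of_degree_cons u hP)).
by rewrite (wedge_deg11 _ _ _ hP) /=; ring.
Qed.

Lemma wedge_deg21 P Q u v w : of_degree 2 P ->
  wedge P Q [:: u; v; w] =
  P [:: u; v] * Q [:: w] - P [:: u; w] * Q [:: v] + P [:: v; w] * Q [:: u].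
Proof.
move=> hP; rewrite (wedge_cons _ _ _ hP) (wedge_deg11 _ _ _ (of_degree_cons u hP)).
rewrite (wedge_cons _ _ _ hP) (wedge_cons _ _ _ hP) wedge_nil.
rewrite (wedge_cons _ _ _ (of_degree_cons v hP)).
rewrite !(wedge_deg0 _ _ (of_degree_cons _ (of_degree_cons _ hP))).
by rewrite !wedge_nil /= !(hP [::]) // !(hP [:: _]) //; ring.
Qed.

Lemma of_degree_wedge k l P Q : of_degree k P -> of_degree l Q ->
  of_degree (k + l) (wedge P Q).
Proof.
move=> hP hQ s skl; rewrite /wedge big1 // => m _.
have [mk|mk] := eqVneq (size (mask m s)) k; last by rewrite hP // mul0r mulr0.
rewrite (hQ (mask (map negb m) s)) ?mulr0 //.
apply: contra skl => /eqP <-; rewrite -mk !size_mask ?size_map ?size_tuple //.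
rewrite count_map -[X in X == _](size_tuple m) -(count_predC id m) eq_refl //.
Qed.

End Wedge.

(** * Bivector fields *)

Section Bivectors.
Context {R : realType} {n : nat} {M : manifold R n}.
Local Notation C := (smoothfun M).
Local Notation mv := (seq (form1 M) -> smoothfun M).
Implicit Types (p q k : nat) (X Y : vfield M) (f g h : C).
Implicit Types (al be ga : form1 M) (P Q : mv).

Lemma alternating_of_degree k P : alternating k P -> of_degree k P.
Proof. by case. Qed.

Lemma mvD P Q s : (P + Q) s = P s + Q s. Proof. by []. Qed.

Lemma alternating_add k P Q : alternating k P -> alternating k Q ->
  alternating k (P + Q).
Proof.
move=> [hP lP aP] [hQ lQ aQ]; split=> [s sk|s t a u v|s t r u]; rewrite !mvD.
- by rewrite hP // hQ // addr0.
- by rewrite lP lQ; ring.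
- by rewrite aP aQ addr0.
Qed.

Lemma alternating0 k : alternating k (0 : mv).
Proof.
split=> // s t a u v; rewrite -[LHS]/(0 : C) -[RHS]/(a * (0 : C) + 0).
by rewrite mulr0 addr0.
Qed.

Lemma alternating_sum k (I : Type) (r : seq I) (F : I -> mv) :
  (forall i, alternating k (F i)) -> alternating k (\sum_(i <- r) F i).
Proof.
move=> aF; elim: r => [|i r IHr]; first by rewrite big_nil; exact: alternating0.
by rewrite big_cons; exact: alternating_add.
Qed.

Lemma alternating_scale k (f : C) P : alternating k P ->
  alternating k (fun s => f * P s).
Proof.
move=> [hP lP aP]; split=> [s sk|s t a u v|s t r u].
- by rewrite hP // mulr0.
- by rewrite lP; ring.
- by rewrite aP mulr0.
Qed.

Lemma alternating_fun f : alternating 0 (mv_fun f : mv).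
Proof.
split=> [[]//|s t a u v|s t r u]; first by case: s => /= *; rewrite mulr0 addr0.
by case: s.
Qed.

Lemma alternating_vfield X : alternating 1 (mv_vfield X : mv).
Proof.
split=> [[|? []]//|s t a u v|s t r u].
  case: s => [|? []] /= *; last 2 first.
  - by rewrite mulr0 addr0.
  - by rewrite mulr0 addr0.
  by case: t => [|? ?]; rewrite ?mulr0 ?addr0.
by case: s => [|? []] //; case: t.
Qed.

Lemma wedge_fun f P : wedge (mv_fun f) P = (fun s => f * P s).
Proof.
apply/funext => s; rewrite wedge_deg0 //.
exact: alternating_of_degree (alternating_fun f).
Qed.

Definition mv2 (b : form1 M -> form1 M -> C) : mv :=
  fun s => if s is [:: al; be] then b al be else 0.

Lemma alternating_mv2 (b : form1 M -> form1 M -> C) :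
  (forall h al al' be, b (h *: al + al') be = h * b al be + b al' be) ->
  (forall h al al' be, b be (h *: al + al') = h * b be al + b be al') ->
  (forall al, b al al = 0) -> alternating 2 (mv2 b).
Proof.
move=> bl br ba; split=> [[|? [|? []]]//|s t a u v|s t r u].
  case: s => [|x [|y [|z s]]] /=; last by rewrite mulr0 addr0.
  - by case: t => [|y [|z t]] //=; rewrite ?mulr0 ?addr0.
  - by case: t => [|y t] //=; rewrite ?mulr0 ?addr0.
  - by rewrite mulr0 addr0.
case: s => [|x [|y s]] //=; first by case: t => [|y t] //=; [case: r|case: t].
- by case: t => [|y t] //=; case: t.
- by case: s.
Qed.

Section AlternatingBivector.
Variables (P : mv) (aP : alternating 2 P).

Lemma bivector_linl h al al' be :
  P [:: h *: al + al'; be] = h * P [:: al; be] + P [:: al'; be].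
Proof. by case: aP => _ lP _; exact: (lP [::] [:: be]). Qed.

Lemma bivector_linr h al al' be :
  P [:: be; h *: al + al'] = h * P [:: be; al] + P [:: be; al'].
Proof. by case: aP => _ lP _; exact: (lP [:: be] [::]). Qed.

Lemma bivectorxx al : P [:: al; al] = 0.
Proof. by case: aP => _ _ a0; exact: (a0 [::] [::] [::]). Qed.

(** Expand P on the pair with both entries equal to al + be. *)
Lemma bivectorC al be : P [:: be; al] = - P [:: al; be].
Proof.
apply/eqP; rewrite -addr_eq0; apply/eqP.
have := bivectorxx (1 *: al + be).
rewrite bivector_linl !bivector_linr !bivectorxx; move=> H.
by rewrite -[RHS]H; ring.
Qed.

Lemma bivector_addr al al' be : P [:: be; al + al'] = P [:: be; al] + P [:: be; al'].
Proof. by rewrite -[al in LHS]scale1r bivector_linr mul1r. Qed.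

Lemma bivector0r be : P [:: be; 0] = 0.
Proof. by apply: (addIr (P [:: be; 0])); rewrite -bivector_addr addr0 add0r. Qed.

Lemma bivector_scaler h al be : P [:: be; h *: al] = h * P [:: be; al].
Proof. by rewrite -[_ *: al]addr0 bivector_linr bivector0r addr0. Qed.

Lemma bivector_sumr (I : Type) (r : seq I) (F : I -> form1 M) be :
  P [:: be; \sum_(i <- r) F i] = \sum_(i <- r) P [:: be; F i].
Proof.
by elim: r => [|i r IHr]; rewrite ?big_nil ?bivector0r // !big_cons bivector_addr IHr.
Qed.

End AlternatingBivector.

Definition decomposable (XY : vfield M * vfield M) : mv :=
  wedge (mv_vfield XY.1) (mv_vfield XY.2).

Lemma decomposableE XY al be :
  decomposable XY [:: al; be] = al XY.1 * be XY.2 - be XY.1 * al XY.2.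
Proof. by rewrite /decomposable wedge_deg11 //; case: (alternating_vfield XY.1). Qed.

Lemma alternating_decomposable XY : alternating 2 (decomposable XY).
Proof.
have h : of_degree 2 (decomposable XY).
  by apply: (@of_degree_wedge _ _ 1 1);
    [case: (alternating_vfield XY.1)|case: (alternating_vfield XY.2)].
have -> : decomposable XY = mv2 (fun al be => decomposable XY [:: al; be]).
  by apply/funext => -[|a [|b [|c s]]] //=; rewrite h.
apply: alternating_mv2 => *; rewrite !decomposableE ?form1D ?form1Z; ring.
Qed.

Lemma sum_mvE (I : Type) (r : seq I) (F : I -> mv) s :
  (\sum_(i <- r) F i) s = \sum_(i <- r) F i s.
Proof. by elim: r => [|i r IHr]; rewrite ?big_nil // !big_cons -IHr. Qed.

(** With a_i and E_i a local coframe and frame, t^3 al = sum_i al(E_i) a_i; hence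
t^6 P(al, be) is the sum of the al(E_i) be(E_j) P(a_i, a_j).  Each pair {i, j} with
i <> j occurs in both orders, so the sum over all (i, j) of
P(a_i, a_j) E_i /\ E_j is 2 t^6 P. *)
Lemma local_decomposition P (p : M) : alternating 2 P ->
  exists (r : C) (L : seq (vfield M * vfield M)), r p != 0 /\
    wedge (mv_fun r) P = \sum_(XY <- L) decomposable XY.
Proof.
move=> aP; have [t [x [E [tp H]]]] := local_coframe p.
pose a i := t *: dform (x i) - x i *: dform t.
exists (2%:R * t ^+ 3 * t ^+ 3).
exists [seq (P [:: a ij.1; a ij.2] *: E ij.1, E ij.2) |
  ij <- index_enum ('I_n * 'I_n)%type].
split.
  have t3 : (t ^+ 3 : C) p != 0.
    by rewrite !exprS expr0 !smoothfunM smoothfun1 !mulf_neq0 // oner_neq0.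
  rewrite 2!smoothfunM !mulf_neq0 // -[2%:R]/(1 + 1 : C) smoothfunD smoothfun1.
  by rewrite -(natrD _ 1 1) pnatr_eq0.
rewrite wedge_fun big_map.
apply/funext => s; rewrite sum_mvE.
have [s2|s2] := eqVneq (size s) 2; last first.
  rewrite (alternating_of_degree aP s2) mulr0 big1 // => ij _.
  exact: alternating_of_degree (alternating_decomposable _) _ s2.
case: s s2 => [|al [|be []]] // _.
have T : t ^+ 3 * t ^+ 3 * P [:: al; be] =
    \sum_i \sum_j al (E i) * be (E j) * P [:: a i; a j].
  rewrite -mulrA -(bivector_scaler aP) H (bivector_sumr aP) mulr_sumr exchange_big /=.
  apply: eq_bigr => j _; rewrite (bivector_scaler aP) mulrCA.
  rewrite [P _](bivectorC aP) mulrN -(bivector_scaler aP) H (bivector_sumr aP).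
  rewrite -sumrN mulr_sumr; apply: eq_bigr => i _.
  by rewrite (bivector_scaler aP) [P _](bivectorC aP); ring.
rewrite -mulrA -mulrA mulrA.
rewrite -(pair_bigA _ (fun i j =>
  decomposable (P [:: a i; a j] *: E i, E j) [:: al; be])) /=.
have -> : \sum_i \sum_j decomposable (P [:: a i; a j] *: E i, E j) [:: al; be] =
    \sum_i \sum_j al (E i) * be (E j) * P [:: a i; a j] +
    \sum_i \sum_j al (E i) * be (E j) * P [:: a i; a j].
  rewrite [X in _ = _ + X]exchange_big /= -big_split /=.
  apply: eq_bigr => i _; rewrite -big_split /=; apply: eq_bigr => j _.
  rewrite decomposableE /= !form1_scaler [P [:: a j; _]](bivectorC aP); ring.
by rewrite -T; ring.
Qed.

End Bivectors.

(** * The Schouten-Nijenhuis bracket of a bivector field with itself *)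

Section Schouten.
Context {R : realType} {n : nat} {M : manifold R n}.
Local Notation C := (smoothfun M).
Local Notation mv := (seq (form1 M) -> smoothfun M).
Implicit Types (p q k : nat) (X Y : vfield M) (f g h : C).
Implicit Types (al be ga : form1 M) (P Q : mv).
Variable sn : mv -> mv -> mv.
Hypothesis hsn : schouten_nijenhuis sn.

Lemma mvN P s : (- P) s = - P s. Proof. by []. Qed.
Lemma mvZ (c : R) P s : (c *: P) s = c *: P s. Proof. by []. Qed.

(** The sign in the skew-symmetry rule depends only on the parity of
(p + 1)(q + 1), which is decided by computation for given degrees. *)
Lemma sn_skew_even p q P Q : ~~ odd (p.+1 * q.+1) ->
  alternating p P -> alternating q Q -> sn P Q = - sn Q P.
Proof.
by move=> e aP aQ; rewrite (sn_skew hsn aP aQ) -signr_odd (negPf e) expr0 scale1r.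
Qed.

Lemma sn_skew_odd p q P Q : odd (p.+1 * q.+1) ->
  alternating p P -> alternating q Q -> sn P Q = sn Q P.
Proof.
by move=> e aP aQ; rewrite (sn_skew hsn aP aQ) -signr_odd e expr1 scaleN1r opprK.
Qed.

Lemma sn_addl p q P P' Q : alternating p P -> alternating p P' ->
  alternating q Q -> sn (P + P') Q = sn P Q + sn P' Q.
Proof.
by move=> aP aP' aQ; rewrite -[P in LHS]scale1r (sn_linear hsn 1 aP aP' aQ) scale1r.
Qed.

Lemma sn_0l p q Q : alternating q Q -> sn 0 Q = 0 :> mv.
Proof.
move=> aQ; apply: (addIr (sn 0 Q)); rewrite add0r.
by rewrite -(sn_addl (alternating0 p) (alternating0 p) aQ) addr0.
Qed.

Lemma sn_suml p q (I : Type) (r : seq I) (F : I -> mv) Q :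
  (forall i, alternating p (F i)) -> alternating q Q ->
  sn (\sum_(i <- r) F i) Q = \sum_(i <- r) sn (F i) Q.
Proof.
move=> aF aQ; elim: r => [|i r IHr]; first by rewrite !big_nil (sn_0l p aQ).
by rewrite !big_cons (sn_addl (aF i) (alternating_sum _ aF) aQ) IHr.
Qed.

Lemma alternating_wedge_fun p f P : alternating p P ->
  alternating p (wedge (mv_fun f) P).
Proof. by rewrite wedge_fun; exact: alternating_scale. Qed.

Lemma sn_vfield_decomposable X Y Z : sn (mv_vfield X) (decomposable (Y, Z)) =
  decomposable (lie X Y, Z) + decomposable (Y, lie X Z).
Proof.
rewrite [LHS](sn_leibniz hsn (alternating_vfield X) (alternating_vfield Y)
  (alternating_vfield Z)).
by rewrite !(sn_lie hsn) -signr_odd /= expr0 scale1r.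
Qed.

Lemma sn_decomposable_vfield X Y Z : sn (decomposable (Y, Z)) (mv_vfield X) =
  - (decomposable (lie X Y, Z) + decomposable (Y, lie X Z)).
Proof.
rewrite -sn_vfield_decomposable.
exact: (@sn_skew_even 2 1 _ _ isT (alternating_decomposable _) (alternating_vfield X)).
Qed.

Lemma sn_decomposable_fun X Y f al :
  sn (decomposable (X, Y)) (mv_fun f) [:: al] = al X * Y f - X f * al Y.
Proof.
rewrite (@sn_skew_odd 2 0 _ _ isT (alternating_decomposable _) (alternating_fun f)).
rewrite [sn _ _](sn_leibniz hsn (alternating_fun f) (alternating_vfield X)
  (alternating_vfield Y)).
have snf Z : sn (mv_fun f) (mv_vfield Z) = - mv_fun (Z f).
  rewrite -(sn_app hsn).
  exact: (@sn_skew_even 0 1 _ _ isT (alternating_fun f) (alternating_vfield Z)).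
rewrite !snf -signr_odd /= expr1 mvD mvZ scaleN1r.
have N Z : of_degree 0 (- mv_fun (Z f) : mv).
  by move=> [|? ?] // _; rewrite mvN oppr0.
rewrite (wedge_deg0 _ _ (N X)).
rewrite (wedge_cons _ _ _ (alternating_of_degree (alternating_vfield X))).
rewrite !wedge_nil /= !mvN /=; ring.
Qed.

(** Leibniz rule; the term with [f, r] vanishes, as both have degree 0. *)
Lemma sn_scale_fun P r f : alternating 2 P ->
  sn (wedge (mv_fun r) P) (mv_fun f) = wedge (mv_fun r) (sn P (mv_fun f)).
Proof.
move=> aP; have ar := alternating_fun r; have af := alternating_fun f.
rewrite (@sn_skew_odd 2 0 _ _ isT (alternating_wedge_fun r aP) af).
rewrite (sn_leibniz hsn af ar aP) (sn_degree0 hsn af ar) expr0 scale1r.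
rewrite (@sn_skew_odd 0 2 _ _ isT af aP) -[RHS]add0r; congr (_ + _).
by apply/funext => s; exact: wedge0l.
Qed.

(** Both sides are linear in P over the functions, and they agree on the exterior
products of two vector fields. *)
Lemma sn_bivector_fun P f al : alternating 2 P ->
  sn P (mv_fun f) [:: al] = P [:: al; dform f].
Proof.
move=> aP; apply: smoothfun_local => p.
have [r [L [rp rP]]] := local_decomposition p aP; exists r => //.
have -> : r * sn P (mv_fun f) [:: al] = sn (wedge (mv_fun r) P) (mv_fun f) [:: al].
  by rewrite sn_scale_fun // [in RHS]wedge_fun.
rewrite rP.
rewrite (sn_suml (p := 2) _ alternating_decomposable (alternating_fun f)) sum_mvE.
transitivity ((wedge (mv_fun r) P) [:: al; dform f]); last by rewrite wedge_fun.
rewrite rP sum_mvE; apply: eq_bigr => -[X Y] _.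
by rewrite sn_decomposable_fun decomposableE /= mulrC.
Qed.

(** The bracket of functions defined by P, a Poisson bracket when [P, P] = 0. *)
Definition bracket P f g : C := P [:: dform f; dform g].

(** In two bivector fields, so as to polarise the quadratic expression [P, P]. *)
Definition jacobiator P Q f g h : C :=
  bracket P f (bracket Q g h) + bracket P g (bracket Q h f) +
  bracket P h (bracket Q f g).

(** The Leibniz rule reduces the left-hand side to Lie brackets of the four vector
fields; both sides are then the same polynomial in first and second derivatives
of f, g, h. *)
Lemma sn_decomposable2 XY XY' f g h :
  sn (decomposable XY) (decomposable XY') [:: dform f; dform g; dform h] =
  jacobiator (decomposable XY) (decomposable XY') f g h +
  jacobiator (decomposable XY') (decomposable XY) f g h.
Proof.
case: XY XY' => X Y [X' Y'].
have aP := alternating_decomposable (X, Y).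
rewrite [sn _ _](sn_leibniz hsn aP (alternating_vfield X') (alternating_vfield Y')).
rewrite -signr_odd /= expr1 mvD mvZ scaleN1r.
have aS Z : alternating 2 (sn (decomposable (X, Y)) (mv_vfield Z)).
  exact: (sn_degree hsn aP (alternating_vfield Z)).
have d1 (Z : vfield M) := alternating_of_degree (alternating_vfield Z).
have d2 Z := alternating_of_degree (aS Z).
rewrite (wedge_deg21 _ _ _ _ (d2 X')) (wedge_deg12 _ _ _ (d1 X') (d2 Y')).
rewrite !sn_decomposable_vfield !mvN !mvD !decomposableE /=.
rewrite /jacobiator /bracket !decomposableE /=.
rewrite !(derivationB, derivationM) /=.
ring.
Qed.


Lemma sn_bivector_addr P Q Q' : alternating 2 P -> alternating 2 Q ->
  alternating 2 Q' -> sn P (Q + Q') = sn P Q + sn P Q'.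
Proof.
move=> aP aQ aQ'; rewrite (@sn_skew_odd 2 2 _ _ isT aP (alternating_add aQ aQ')).
rewrite (sn_addl aQ aQ' aP) (@sn_skew_odd 2 2 _ _ isT aP aQ).
by rewrite (@sn_skew_odd 2 2 _ _ isT aP aQ').
Qed.

Lemma sn_sum_decomposable (L L' : seq (vfield M * vfield M)) f g h :
  let P := \sum_(XY <- L) decomposable XY in
  let Q := \sum_(XY <- L') decomposable XY in
  sn P Q [:: dform f; dform g; dform h] = jacobiator P Q f g h + jacobiator Q P f g h.
Proof.
have aL K : alternating 2 (\sum_(XY <- K) decomposable XY : mv).
  exact: alternating_sum alternating_decomposable.
have brD P P' u v : bracket (P + P') u v = bracket P u v + bracket P' u v by [].
have br0 u v : bracket 0 u v = 0 by [].
have brA P u v v' : alternating 2 P ->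
    bracket P u (v + v') = bracket P u v + bracket P u v'.
  by move=> aP; rewrite /bracket dformD (bivector_addr aP).
have br0r P u : alternating 2 P -> bracket P u 0 = 0.
  by move=> aP; apply: (addIr (bracket P u 0)); rewrite -brA // addr0 add0r.
move=> P Q; rewrite {}/P {}/Q; elim: L => [|XY L IH].
  rewrite big_nil (sn_0l 2 (aL L')) /jacobiator !br0 !br0r // !addr0 //.
rewrite big_cons (sn_addl (alternating_decomposable XY) (aL L) (aL L')) mvD IH.
have -> : sn (decomposable XY) (\sum_(XY <- L') decomposable XY)
    [:: dform f; dform g; dform h] =
    jacobiator (decomposable XY) (\sum_(XY <- L') decomposable XY) f g h +
    jacobiator (\sum_(XY <- L') decomposable XY) (decomposable XY) f g h.
  have aXY := alternating_decomposable XY.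
  elim: L' {IH} => [|XY' L' IH].
    rewrite big_nil (@sn_skew_odd 2 2 _ _ isT aXY (alternating0 2)) (sn_0l 2 aXY).
    by rewrite /jacobiator !br0 !br0r // !addr0.
  have aXY' := alternating_decomposable XY'.
  rewrite big_cons (sn_bivector_addr aXY aXY' (aL L')) mvD sn_decomposable2 IH.
  by rewrite /jacobiator !brD !brA //; ring.
by rewrite /jacobiator !brD !brA //; try ring; exact: alternating_decomposable.
Qed.

(** Near p, the bivector field Q = r P is a sum of exterior products, for which the
identity is known.  The two sides for Q exceed r^2 times the two sides for P by
terms with a derivative of r: on the left 2 r [P, r] /\ P, and on the right 2 r
times the cyclic sum of P(df, dr) P(dg, dh).  These are equal since
[P, r](al) = P(al, dr). *)
Lemma sn_bivector_self P f g h : alternating 2 P ->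
  sn P P [:: dform f; dform g; dform h] = 2%:R * jacobiator P P f g h.
Proof.
move=> aP; apply: smoothfun_local => p.
have [r [L [rp rP]]] := local_decomposition p aP.
exists (r * r); first by rewrite smoothfunM mulf_neq0.
pose Q := wedge (mv_fun r) P.
have aQ : alternating 2 Q by exact: alternating_wedge_fun.
have QE al be : Q [:: al; be] = r * P [:: al; be] by rewrite /Q wedge_fun.
have ar := alternating_fun r.
have d1 Z : alternating 2 Z -> of_degree 1 (sn Z (mv_fun r)).
  by move=> aZ; case: (sn_degree hsn aZ ar).
have d2 := alternating_of_degree aP.
have aPr : forall al, sn P (mv_fun r) [:: al] = P [:: al; dform r].
  by move=> al; exact: sn_bivector_fun.
have aQr : forall al, sn Q (mv_fun r) [:: al] = r * P [:: al; dform r].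
  by move=> al; rewrite sn_bivector_fun.
have E1 := sn_sum_decomposable L L f g h; rewrite /= -rP -/Q in E1.
have E2 : sn Q Q = wedge (sn Q (mv_fun r)) P + wedge (mv_fun r) (sn Q P).
  by rewrite {2}/Q (sn_leibniz hsn aQ ar aP) -signr_odd /= expr0 scale1r.
have E3 : sn Q P = wedge (sn P (mv_fun r)) P + wedge (mv_fun r) (sn P P).
  rewrite (@sn_skew_odd 2 2 _ _ isT aQ aP).
  by rewrite {1}/Q (sn_leibniz hsn aP ar aP) -signr_odd /= expr0 scale1r.
move: E1; rewrite E2 mvD (wedge_fun r (sn Q P)) E3 mvD (wedge_fun r (sn P P)).
rewrite (wedge_deg12 _ _ _ (d1 _ aQ) d2) (wedge_deg12 _ _ _ (d1 _ aP) d2).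
rewrite !aPr !aQr /jacobiator /bracket !QE !dformM.
rewrite !(bivector_addr aP) !(bivector_scaler aP) !(bivectorC aP (dform f)).
move/eqP; rewrite -subr_eq0 => /eqP E0.
by apply/eqP; rewrite -subr_eq0; apply/eqP; rewrite -[RHS]E0; ring.
Qed.

End Schouten.

(** * The splitting defined by a 2-covariant tensor *)

Section Splitting.
Context {R : realType} {n : nat} {M : manifold R n}.
Local Notation C := (smoothfun M).
Implicit Types (X Y Z : vfield M) (f g h : C) (al be ga : form1 M).

Lemma tensor_linl (T : tensor2 M) h X Y Z : T (h *: X + Y) Z = h * T X Z + T Y Z.
Proof. by have [Tl _] := tensor2P T; rewrite [LHS]Tl. Qed.

Lemma tensor_linr (T : tensor2 M) h X Y Z : T Z (h *: X + Y) = h * T Z X + T Z Y.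
Proof. by have [_ Tr] := tensor2P T; rewrite [LHS]Tr. Qed.

Lemma tensor_addr (T : tensor2 M) X Y Z : T Z (X + Y) = T Z X + T Z Y.
Proof. by rewrite -[X in LHS]scale1r tensor_linr mul1r. Qed.

Lemma tensor_0r (T : tensor2 M) Z : T Z 0 = 0.
Proof. by apply: (addIr (T Z 0)); rewrite -tensor_addr addr0 add0r. Qed.

Lemma tensor_scaler (T : tensor2 M) h X Z : T Z (h *: X) = h * T Z X.
Proof. by rewrite -[_ *: X]addr0 tensor_linr tensor_0r addr0. Qed.

Lemma tensor_subr (T : tensor2 M) X Y Z : T Z (X - Y) = T Z X - T Z Y.
Proof. by rewrite tensor_addr -scaleN1r tensor_scaler mulN1r. Qed.

Lemma lieE X Y f : lie X Y f = X (Y f) - Y (X f). Proof. by []. Qed.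

Lemma lie_linl h X Y Z : lie (h *: X + Y) Z =
  h *: lie X Z + (- Z h) *: X + lie Y Z.
Proof.
apply: vfield_ext => f.
rewrite !(vfieldD, vfieldZ, lieE) derivationD derivationM; ring.
Qed.

Lemma lie_linr h X Y Z : lie Z (h *: X + Y) = h *: lie Z X + Z h *: X + lie Z Y.
Proof.
apply: vfield_ext => f.
rewrite !(vfieldD, vfieldZ, lieE) derivationD derivationM; ring.
Qed.

Lemma half_double f : (2^-1 : R) *: (f + f) = f.
Proof. by apply: smoothfun_ext => q; rewrite smoothfunZ smoothfunD; field. Qed.

Variable B : tensor2 M.
Let w := skew_part B.
Let S := sym_part B.
Let H := tensor_ker S.
Let V := tensor_ker w.

Lemma tensor_split X Y : B X Y = w X Y + S X Y.
Proof.
transitivity ((2^-1 : R) *: (B X Y + B X Y)); first by rewrite half_double.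
by rewrite /= -scalerDr; congr (_ *: _); ring.
Qed.

Lemma skewC X Y : w X Y = - w Y X.
Proof. by rewrite /= -scalerN opprB. Qed.

Lemma skewxx X : w X X = 0.
Proof. by rewrite /= subrr scaler0. Qed.

Lemma symC X Y : S X Y = S Y X.
Proof. by rewrite /= addrC. Qed.

Lemma tensor_kerE (T : tensor2 M) X : tensor_ker T X <-> forall Y, T X Y = 0.
Proof.
split=> [TX Y|TX]; first by rewrite -[T X Y]/(hat T X Y) TX.
by apply: form1_ext => Y; exact: TX.
Qed.

Lemma tensor_ker_lin (T : tensor2 M) h X Y : tensor_ker T X -> tensor_ker T Y ->
  tensor_ker T (h *: X + Y).
Proof.
move=> /tensor_kerE TX /tensor_kerE TY; apply/tensor_kerE => Z.
by rewrite tensor_linl TX TY mulr0 addr0.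
Qed.

Hypothesis HV : direct_sum H V.
Local Notation prH := (proj_along H V).
Local Notation prV := (proj_along V H).

Lemma projH_spec X : H (prH X) /\ V (X - prH X).
Proof.
have [Y [HY _]] := HV X; rewrite /proj_along.
by case: xgetP => [_ -> //|/(_ Y)]; case.
Qed.

Lemma projH_unique X Y : H Y -> V (X - Y) -> prH X = Y.
Proof.
move=> HY VY; have [Z [_ HZ]] := HV X.
by rewrite -(HZ _ (projH_spec X)) -(HZ Y).
Qed.

Lemma projH_lin h X Y : prH (h *: X + Y) = h *: prH X + prH Y.
Proof.
have [HX VX] := projH_spec X; have [HY VY] := projH_spec Y.
apply: projH_unique; first exact: tensor_ker_lin.
by rewrite opprD addrACA -scalerBr; exact: tensor_ker_lin.
Qed.

(** V and H play symmetric roles in a direct sum. *)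
Lemma projVE X : prV X = X - prH X.
Proof.
have [HX VX] := projH_spec X; rewrite [LHS]/proj_along.
case: xgetP => [Y _ [VY HY]|/(_ (X - prH X)) nVH]; last first.
  by exfalso; apply: nVH; split=> //; rewrite subKr.
have <- : X - Y = prH X.
  by apply/esym/projH_unique; [exact: HY|rewrite subKr; exact: VY].
by rewrite subKr.
Qed.

Lemma skew_projHr X Y : w X (prH Y) = w X Y.
Proof.
have [_ /tensor_kerE VY] := projH_spec Y; apply/esym/eqP.
by rewrite -subr_eq0 -tensor_subr skewC VY oppr0.
Qed.

Lemma skew_projHl X Y : w (prH X) Y = w X Y.
Proof. by rewrite skewC skew_projHr -skewC. Qed.

Lemma sym_projHr X Y : S X (prH Y) = 0.
Proof. by have [/tensor_kerE HY _] := projH_spec Y; rewrite symC HY. Qed.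

(** S vanishes on horizontal vectors, and w does not see vertical components. *)
Lemma tensor_projHr X Y : B X (prH Y) = w X Y.
Proof. by rewrite tensor_split sym_projHr addr0 skew_projHr. Qed.

Definition horizontal_term X Y Z : C := B X (lie (prH Y) (prH Z)) + prH X (w Y Z).

(** For a bivector field P with contraction P#, the 3-vector field [P, P] / 2 sends
(al, be, ga) to the cyclic sum of al([P# be, P# ga]) - P#al(P(be, ga)).  This is
that expression for the bivector field of w, in which P#(hat B X) = - X_H, written
in terms of vector fields. *)
Definition horizontal_form X Y Z : C :=
  horizontal_term X Y Z + horizontal_term Y Z X + horizontal_term Z X Y.

Lemma horizontal_form_cycle X Y Z : horizontal_form X Y Z = horizontal_form Y Z X.
Proof. by rewrite /horizontal_form -addrA addrC. Qed.

(** A factor h in front of X is differentiated along Y_H and Z_H, in the Lie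
brackets and in the terms X_H(w(Y, Z)); the resulting terms cancel in pairs
because B(Y, X_H) = w(Y, X). *)
Lemma horizontal_form_linl h X X' Y Z :
  horizontal_form (h *: X + X') Y Z =
  h * horizontal_form X Y Z + horizontal_form X' Y Z.
Proof.
rewrite /horizontal_form /horizontal_term !projH_lin.
rewrite lie_linl lie_linr !tensor_linl !tensor_linr !tensor_addr.
rewrite !tensor_scaler !tensor_projHr !vfieldD !vfieldZ !derivationD !derivationM.
rewrite [w Z X]skewC [w Y X]skewC; ring.
Qed.

End Splitting.

(** * The two sides on exact forms *)

Section ExactForms.
Context {R : realType} {n : nat} {M : manifold R n}.
Local Notation C := (smoothfun M).
Implicit Types (X Y Z : vfield M) (f g h : C) (al be ga : form1 M).

(** Each term of the differential evaluates b on one argument fewer. *)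
Lemma extd_of_degree (b : seq (vfield M) -> C) k : of_degree k b ->
  of_degree k.+1 (extd b).
Proof.
move=> hb s sk.
have sz (i : nat) (r : seq (vfield M)) : (i < size r)%N ->
    size (del i r) = (size r).-1.
  move=> ir; rewrite size_cat size_take size_drop ir; lia.
rewrite /extd big1 ?add0r => [|i _]; last first.
  rewrite (hb (del _ s)) ?derivation0 ?mulr0 // sz //.
  apply: contra sk => /eqP <-; rewrite prednK //.
  exact: leq_ltn_trans (ltn_ord i).
rewrite big1 // => j _; rewrite big1 // => i _.
have j0 : (0 < j)%N := leq_ltn_trans (leq0n i) (ltn_ord i).
have s1 : (1 < size s)%N := leq_ltn_trans j0 (ltn_ord j).
have s0 : (0 < (size s).-1)%N by rewrite -ltnS prednK // ltnW.
have sj := sz _ _ (ltn_ord j).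
rewrite (hb (_ :: _)) ?mulr0 //= sz sj.
  by apply: contra sk => /eqP <-; rewrite prednK // prednK // ltnW.
by apply: leq_trans (ltn_ord i) _; rewrite -ltnS prednK // ltnW.
Qed.

Lemma form2_of_degree (T : tensor2 M) : of_degree 2 (form2 T).
Proof. by move=> [|? [|? [|? ?]]]. Qed.

Lemma extd_form2 (T : tensor2 M) X Y Z :
  extd (form2 T) [:: X; Y; Z] =
  X (T Y Z) - Y (T X Z) + Z (T X Y) -
  T (lie X Y) Z + T (lie X Z) Y - T (lie Y Z) X.
Proof.
rewrite /extd !big_ord_recl !big_ord0 /=.
by rewrite /fintype.bump /=; ring.
Qed.

Variable B : tensor2 M.
Let w := skew_part B.
Let S := sym_part B.
Let H := tensor_ker S.
Let V := tensor_ker w.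
Hypothesis HV : direct_sum H V.
Local Notation prH := (proj_along H V).

(** In B(X, [Y_H, Z_H]) the part w depends only on X_H and contributes to d w, and
the part S only on the vertical component of the bracket, the curvature. *)
Lemma horizontal_formE X Y Z :
  (Lambda_tr prH (extd (form2 w)) + (2^-1 : R) *: barwedge S (curv H V)) [:: X; Y; Z] =
  horizontal_form B X Y Z.
Proof.
have T X' Y' Z' : horizontal_term B X' Y' Z' =
    w (prH X') (lie (prH Y') (prH Z')) + prH X' (w (prH Y') (prH Z')) +
    S X' (curv H V Y' Z').
  rewrite /horizontal_term tensor_split // /curv projVE // tensor_subr.
  rewrite sym_projHr // subr0.
  by rewrite skew_projHl // skew_projHl // skew_projHr //; ring.
rewrite /horizontal_form !T.
rewrite -[LHS]/(extd (form2 w) [:: prH X; prH Y; prH Z] + (2^-1 : R) *: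
  (2%:R * (S X (curv H V Y Z) + S Y (curv H V Z X) + S Z (curv H V X Y)))).
rewrite extd_form2 mulr_natl mulr2n half_double.
have wlie a b c : w a (lie b c) = - w a (lie c b).
  have -> : lie b c = -1 *: lie c b.
    by apply: vfield_ext => f; rewrite vfieldZ !lieE mulN1r opprB.
  by rewrite tensor_scaler mulN1r.
rewrite (skewC B (lie (prH X) (prH Y))) (skewC B (lie (prH X) (prH Z))).
rewrite (skewC B (lie (prH Y) (prH Z))) (skewC B (prH X) (prH Z)) derivationN.
rewrite -/w (wlie (prH Y) (prH X)); ring.
Qed.

Hypothesis Bnd : nondeg_tensor B.
Local Notation sharp := (hat_inv B).

Lemma hat_invK al : hat B (sharp al) = al.
Proof.
case: Bnd => g gK Kg; rewrite /hat_inv; case: xgetP => [X _ //|/(_ (g al))].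
by case; exact: Kg.
Qed.

Lemma hatK X : sharp (hat B X) = X.
Proof. by apply: (bij_inj Bnd); exact: hat_invK. Qed.

Lemma sharpE al X : B (sharp al) X = al X.
Proof. by rewrite -[LHS]/(hat B (sharp al) X) hat_invK. Qed.

Lemma sharp_lin h al be : sharp (h *: al + be) = h *: sharp al + sharp be.
Proof.
apply: (bij_inj Bnd); rewrite hat_invK; apply: form1_ext => X.
by rewrite form1D form1Z -[RHS]/(B _ _) tensor_linl !sharpE.
Qed.

Lemma bivector_alternating : alternating 2 (Lambda_tr sharp (form2 w)).
Proof.
rewrite (_ : Lambda_tr sharp (form2 w) = mv2 (fun al be => w (sharp al) (sharp be))).
  apply: alternating_mv2 => [h al al' be|h al al' be|al].
  - by rewrite sharp_lin tensor_linl.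
  - by rewrite sharp_lin tensor_linr.
  - exact: skewxx.
by apply/funext => -[|a [|b [|c s]]].
Qed.

(** If hat B X = df then B(X, Y_H) = Y_H f, so that horizontal derivatives are
brackets: Y_H f = {f, g} if moreover hat B Y = dg.  The Lie brackets of
horizontal fields thus contribute 2 J, and the derivatives of w contribute - J,
where J is the jacobiator. *)
Lemma horizontal_form_exact f g h :
  jacobiator (Lambda_tr sharp (form2 w)) (Lambda_tr sharp (form2 w)) f g h =
  horizontal_form B (sharp (dform f)) (sharp (dform g)) (sharp (dform h)).
Proof.
pose W u v := w (sharp (dform u)) (sharp (dform v)).
have Wskew u v : W u v = - W v u by exact: skewC.
have WE u v : prH (sharp (dform v)) u = W u v by rewrite /W -tensor_projHr // sharpE.
have WN u v : W (- u) v = - W u v by rewrite -!WE derivationN.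
rewrite -[LHS]/(W f (W g h) + W g (W h f) + W h (W f g)).
rewrite /horizontal_form /horizontal_term !sharpE !dformE !lieE.
rewrite -![w (sharp _) (sharp _)]/(W _ _) !WE.
rewrite (Wskew f h) (Wskew g f) (Wskew h g) !WN.
rewrite (Wskew f (W g h)) (Wskew g (W h f)) (Wskew h (W f g)); ring.
Qed.

End ExactForms.

Theorem theorem4p4 (R : realType) (n : nat) (M : manifold R n)
    (sn : (seq (form1 M) -> smoothfun M) -> (seq (form1 M) -> smoothfun M) ->
          (seq (form1 M) -> smoothfun M))
    (hsn : schouten_nijenhuis sn)
    (B : tensor2 M) (hB : nondeg_tensor B) :
  let w := skew_part B in
  let S := sym_part B in
  let H := tensor_ker S in
  let V := tensor_ker w in
  direct_sum H V ->
  (2^-1 : R) *: conj_bracket sn B (form2 w) (form2 w) =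
  Lambda_tr (proj_along H V) (extd (form2 w)) +
  (2^-1 : R) *: barwedge S (curv H V).
Proof.
move=> w S H V HV; pose P := Lambda_tr (hat_inv B) (form2 w).
have aP : alternating 2 P := bivector_alternating hB.
have [sn3 snl _] : alternating 3 (sn P P) := sn_degree hsn aP aP isT.
pose A al be ga := horizontal_form B (hat_inv B al) (hat_inv B be) (hat_inv B ga).
(* both sides are linear over the functions in each form, so exact forms suffice *)
have key al be ga : sn P P [:: al; be; ga] = 2%:R * A al be ga.
  have Al h u v x y : A (h *: u + v) x y = h * A u x y + A v x y.
    by rewrite /A sharp_lin // horizontal_form_linl.
  have Ac x y z : A x y z = A y z x by exact: horizontal_form_cycle.
  apply/eqP; rewrite -subr_eq0; apply/eqP.
  apply: (exact_span (F := fun u => sn P P [:: u; be; ga] - 2%:R * A u be ga)).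
    by move=> h u v; rewrite (snl [::] [:: be; ga]) Al /=; ring.
  move=> f; move: be; apply: (exact_span
    (F := fun u => sn P P [:: dform f; u; ga] - 2%:R * A (dform f) u ga)).
    move=> h u v; rewrite (snl [:: dform f] [:: ga]) !(Ac (dform f)) Al /=; ring.
  move=> g; move: ga; apply: (exact_span
    (F := fun u => sn P P [:: dform f; dform g; u] - 2%:R * A (dform f) (dform g) u)).
    move=> h u v; rewrite (snl [:: dform f; dform g] [::]) -!(Ac _ (dform f)) Al /=.
    ring.
  move=> h; rewrite (sn_bivector_self hsn _ _ _ aP) horizontal_form_exact //.
  by rewrite subrr.
apply/funext => s; have [s3|s3] := eqVneq (size s) 3; last first.
  rewrite -[LHS]/((2^-1 : R) *: sn P P (map (hat B) s)) sn3 ?size_map // scaler0.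
  rewrite -[RHS]/(extd (form2 w) (map (proj_along H V) s) +
    (2^-1 : R) *: barwedge S (curv H V) s).
  rewrite (extd_of_degree (@form2_of_degree _ _ _ w)) ?size_map //.
  by case: s s3 => [|? [|? [|? [|? ?]]]] //= _; rewrite scaler0 addr0.
case: s s3 => [|X [|Y [|Z []]]] // _.
rewrite horizontal_formE //.
rewrite -[LHS]/((2^-1 : R) *: sn P P [:: hat B X; hat B Y; hat B Z]).
by rewrite key mulr_natl mulr2n half_double /A !hatK.
Qed.
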